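(* Suppose that $\beta=0$. Let $\mathcal{I}$ be an ideal of $\mathcal{K}_j$. (a) If $\mathcal{I}=\{0\}$, then $\mathcal{I}^\perp=\widehat{\mathcal{K}_j}=\mathcal{R}_2[x]/\langle k_j^*(x)\rangle$. (b) If $\mathcal{I}=\mathcal{K}_j$, then $\mathcal{I}^\perp=\{0\}$. (c) If $\mathcal{I}=\langle\gamma f_j(x)^\tau\rangle$ is of Type II, then $\mathcal{I}^\perp=\langle f_j^*(x)^{p^s-\tau},\gamma\rangle$. In (d)(ii) and (e)(ii) below write $\gamma(M_j(x)-G(x))=\gamma f_j(x)^\delta A_G(x)$ in $\mathcal{K}_j$, where $0\le\delta<p^s$ and $A_G(x)$ is either $0$ or a unit in $\mathcal{K}_j$. (d) Let $\mathcal{I}=\langle f_j(x)^\omega+\gamma f_j(x)^tG(x)\rangle$ be of Type III. (i) When $\operatorname{char}\mathcal{R}_2=p$: • if $G=0$, $\mathcal{I}^\perp=\langle f_j^*(x)^{p^s-\omega}\rangle$; • if $G\neq0$ and $p^s-2\omega+t\ge0$, $\mathcal{I}^\perp=\langle f_j^*(x)^{p^s-\omega}-\gamma x^{d_j\omega-d_jt-\deg G}f_j^*(x)^{p^s-2\omega+t}G^*(x)\rangle$; • if $G\neq0$ and $p^s-2\omega+t<0$, $\mathcal{I}^\perp=\langle f_j^*(x)^{\omega-t}-\gamma x^{d_j\omega-d_jt-\deg G}G^*(x),\ \gamma f_j^*(x)^{p^s-\omega}\rangle$. (ii) Let $\operatorname{char}\mathcal{R}_2=p^2$. When $G\neq0$,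 $t=\omega-p^s+p^{s-1}$ with either $A_G=0$ or $A_G\neq0$ and $\delta\ge p^s-p^{s-1}$, we have $\mathcal{I}=\langle f_j(x)^\omega+\gamma f_j(x)^{\omega-p^s+p^{s-1}}M_j(x)\rangle$. Furthermore: • if $G=0$ and $\omega\le p^{s-1}$, $\mathcal{I}^\perp=\langle f_j^*(x)^{p^s-\omega}+\gamma x^{d_jp^s-d_jp^{s-1}-\deg M_j}f_j^*(x)^{p^{s-1}-\omega}M_j^*(x)\rangle$; • if $G=0$ and $\omega>p^{s-1}$, $\mathcal{I}^\perp=\langle f_j^*(x)^{p^s-p^{s-1}}+\gamma x^{d_jp^s-d_jp^{s-1}-\deg M_j}M_j^*(x),\ \gamma f_j^*(x)^{p^s-\omega}\rangle$; • if $G\neq0$, $p^s-p^{s-1}+t-\omega>0$ and $\omega>p^{s-1}$, $\mathcal{I}^\perp=\langle f_j^*(x)^{p^s-p^{s-1}}+\gamma x^{d_jp^s-d_jp^{s-1}-\deg M_j}M_j^*(x)-\gamma x^{d_j\omega-d_jt-\deg G}f_j^*(x)^{p^s+t-\omega-p^{s-1}}G^*(x),\ \gamma f_j^*(x)^{p^s-\omega}\rangle$; • if $G\neq0$, $p^s-p^{s-1}+t-\omega>0$ and $\omega\le p^{s-1}$, $\mathcal{I}^\perp=\langle f_j^*(x)^{p^s-\omega}+\gamma x^{d_jp^s-d_jp^{s-1}-\deg M_j}f_j^*(x)^{p^{s-1}-\omega}M_j^*(x)-\gamma x^{d_j\omega-d_jt-\deg G}f_j^*(x)^{p^s+t-2\omega}G^*(x)\rangle$;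 • if $G\neq0$, $p^s-p^{s-1}+t-\omega<0$ and $p^s-2\omega+t\ge0$, $\mathcal{I}^\perp=\langle f_j^*(x)^{p^s-\omega}+\gamma x^{d_jp^s-d_jp^{s-1}-\deg M_j}f_j^*(x)^{p^{s-1}-\omega}M_j^*(x)-\gamma x^{d_j\omega-d_jt-\deg G}f_j^*(x)^{p^s+t-2\omega}G^*(x)\rangle$; • if $G\neq0$, $p^s-p^{s-1}+t-\omega<0$ and $p^s-2\omega+t<0$, $\mathcal{I}^\perp=\langle f_j^*(x)^{\omega-t}+\gamma x^{d_jp^s-d_jp^{s-1}-\deg M_j}f_j^*(x)^{p^{s-1}+\omega-t-p^s}M_j^*(x)-\gamma x^{d_j\omega-d_jt-\deg G}G^*(x),\ \gamma f_j^*(x)^{p^s-\omega}\rangle$; • if $G\neq0$, $\omega=p^s-p^{s-1}+t$ with either $A_G=0$ or $A_G\neq0$, $\delta\ge p^s-p^{s-1}$, $\mathcal{I}^\perp=\langle f_j^*(x)^{p^s-\omega}\rangle$; • if $G\neq0$, $t=\omega-p^s+p^{s-1}$, $A_G\neq0$ and $\omega-p^{s-1}\le\delta<p^s-p^{s-1}$, $\mathcal{I}^\perp=\langle f_j^*(x)^{p^s-\omega}+\gamma x^{d_jp^s-d_jp^{s-1}-d_j\delta-\deg A_G}f_j^*(x)^{p^{s-1}-\omega+\delta}A_G^*(x)\rangle$; • if $G\neq0$, $t=\omega-p^s+p^{s-1}$, $A_G\neq0$ and $\delta<\omega-p^{s-1}$, $\mathcal{I}^\perp=\langle f_j^*(x)^{p^s-p^{s-1}-\delta}+\gamma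 x^{d_jp^s-d_jp^{s-1}-d_j\delta-\deg A_G}A_G^*(x),\ \gamma f_j^*(x)^{p^s-\omega}\rangle$. (e) Let $\mathcal{I}=\langle f_j(x)^\omega+\gamma f_j(x)^tG(x),\gamma f_j(x)^\mu\rangle$ be of Type IV. (i) When $\operatorname{char}\mathcal{R}_2=p$: • if $G=0$, $\mathcal{I}^\perp=\langle f_j^*(x)^{p^s-\mu},\ \gamma f_j^*(x)^{p^s-\omega}\rangle$; • if $G\neq0$, $\mathcal{I}^\perp=\langle f_j^*(x)^{p^s-\mu}-\gamma x^{d_j\omega-d_jt-\deg G}f_j^*(x)^{p^s-\mu-\omega+t}G^*(x),\ \gamma f_j^*(x)^{p^s-\omega}\rangle$. (ii) Let $\operatorname{char}\mathcal{R}_2=p^2$. When $G\neq0$, $t=\omega-p^s+p^{s-1}$ with either $A_G=0$ or $A_G\neq0$ and $\delta\ge p^s-p^{s-1}$, we have $\mathcal{I}=\langle f_j(x)^\omega+\gamma f_j(x)^{\omega-p^s+p^{s-1}}M_j(x),\gamma f_j(x)^\mu\rangle$. Furthermore: • if $G=0$ and $p^s-p^{s-1}-\omega+\mu\le0$, $\mathcal{I}^\perp=\langle f_j^*(x)^{p^s-\mu},\ \gamma f_j^*(x)^{p^s-\omega}\rangle$; • if $G=0$ and $p^s-p^{s-1}-\omega+\mu>0$, $\mathcal{I}^\perp=\langle f_j^*(x)^{p^s-\mu}+\gamma x^{d_jp^s-d_jp^{s-1}-\deg M_j}f_j^*(x)^{p^{s-1}-\mu}M_j^*(x),\ \gamma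 f_j^*(x)^{p^s-\omega}\rangle$; • if $G\neq0$ and $p^s-p^{s-1}+t-\omega\neq0$, $\mathcal{I}^\perp=\langle f_j^*(x)^{p^s-\mu}+\gamma x^{d_jp^s-d_jp^{s-1}-\deg M_j}f_j^*(x)^{p^{s-1}-\mu}M_j^*(x)-\gamma x^{d_j\omega-d_jt-\deg G}f_j^*(x)^{p^s-\mu+t-\omega}G^*(x),\ \gamma f_j^*(x)^{p^s-\omega}\rangle$; • if $G\neq0$, $t=\omega-p^s+p^{s-1}$ with either $A_G=0$ or $A_G\neq0$, $\delta\ge p^s-p^{s-1}$, $\mathcal{I}^\perp=\langle f_j^*(x)^{p^s-\mu},\ \gamma f_j^*(x)^{p^s-\omega}\rangle$; • if $G\neq0$, $t=\omega-p^s+p^{s-1}$, $A_G\neq0$ and $\delta<p^s-p^{s-1}$, $\mathcal{I}^\perp=\langle f_j^*(x)^{p^s-\mu}+\gamma x^{d_jp^s-d_jp^{s-1}-d_j\delta-\deg A_G}f_j^*(x)^{p^{s-1}-\mu+\delta}A_G^*(x),\ \gamma f_j^*(x)^{p^s-\omega}\rangle$.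
   Context: $\mathcal{R}_2$ is a finite commutative chain ring with unity, with maximal ideal $\langle\gamma\rangle$, where $\gamma\neq0$ and $\gamma^2=0$; its residue field has order $p^m$, $p$ prime; $\operatorname{char}\mathcal{R}_2\in\{p,p^2\}$. $\zeta\in\mathcal{R}_2$ has multiplicative order $p^m-1$ and $\mathcal{T}_2=\{0,1,\zeta,\dots,\zeta^{p^m-2}\}$. $n,s$ are positive integers with $\gcd(n,p)=1$. $\alpha\in\mathcal{T}_2\setminus\{0\}$, $\beta\in\mathcal{T}_2$, $\lambda=\alpha+\gamma\beta$, and $\alpha_0\in\mathcal{T}_2$ satisfies $\alpha_0^{p^s}=\alpha$. Write $x^n-\alpha_0=f_1(x)\cdots f_r(x)$ with $f_j$ monic, pairwise coprime and basic irreducible (irreducible modulo $\gamma$) in $\mathcal{R}_2[x]$, $d_j=\deg f_j$. Then $x^{np^s}-\lambda=\prod_{j=1}^rk_j(x)$ with $k_j=f_j^{p^s}+\gamma g_j$ monic, pairwise coprime, of degree $d_jp^s$ (uniquely determined). When $\beta=0$: if $\operatorname{char}\mathcal{R}_2=p$ then $k_j=f_j^{p^s}$; if $\operatorname{char}\mathcal{R}_2=p^2$ one can take $g_j=f_j^{p^{s-1}}M_j$ with $M_j\in\mathcal{R}_2[x]$ coprime to $f_j$; fix such $M_j$. Fix $1\le j\le r$ and put $\mathcal{K}_j=\mathcal{R}_2[x]/\langle k_j(x)\rangle$, $\widehat{\mathcal{K}_j}=\mathcal{R}_2[x]/\langle k_j^*(x)\rangle$. For a nonzero polynomial $f$, $f^*(x)=x^{\deg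 f}f(x^{-1})$, and $0^*=0$; elements of $\mathcal{K}_j$ are represented by polynomials of degree less than $d_jp^s$. Since $x$ is a unit in $\widehat{\mathcal{K}_j}$, any integer power of $x$ makes sense there. The orthogonal complement of an ideal $\mathcal{I}$ of $\mathcal{K}_j$ is $\mathcal{I}^\perp=\{a(x)\in\widehat{\mathcal{K}_j}:a(x)c^*(x)=0\text{ in }\widehat{\mathcal{K}_j}\ \forall c(x)\in\mathcal{I}\}$; all ideals displayed for $\mathcal{I}^\perp$ are ideals of $\widehat{\mathcal{K}_j}$. $\mathcal{P}_{d_j}(\mathcal{T}_2)$ denotes the set of polynomials with coefficients in $\mathcal{T}_2$ that are $0$ or of degree less than $d_j$. For $\beta=0$ the ideals of $\mathcal{K}_j$ are: Type I: $\{0\}$, $\mathcal{K}_j$. Type II: $\langle\gamma f_j^\tau\rangle$, $0\le\tau<p^s$. Type III: $\langle f_j^\omega+\gamma f_j^tG\rangle$, where $0<\omega<p^s$, $0\le t<\kappa$ if $G\neq0$, and $G$ is $0$ or a unit of $\mathcal{K}_j$ of the form $\sum_{i=0}^{\kappa-t-1}a_i(x)f_j(x)^i$ with $a_i\in\mathcal{P}_{d_j}(\mathcal{T}_2)$. Type IV: $\langle f_j^\omega+\gamma f_j^tG,\gamma f_j^\mu\rangle$, where $0\le\mu<\kappa\le\omega<p^s$, $0\le t<\mu$ if $G\neq0$, and $G$ is $0$ or a unit of $\mathcal{K}_j$ of the form $\sum_{i=0}^{\mu-t-1}a_i(x)f_j(x)^i$ with $a_i\in\mathcal{P}_{d_j}(\mathcal{T}_2)$.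 In both types $\kappa$ is the smallest non-negative integer with $\gamma f_j^\kappa\in\langle f_j^\omega+\gamma f_j^tG\rangle$ (so $\kappa\le\omega$). *)

(* Defs.v *)
From HB Require Import structures.
From mathcomp Require Import all_boot all_order all_algebra.
From mathcomp Require Import qpoly.

Set Implicit Arguments.
Unset Strict Implicit.
Unset Printing Implicit Defensive.

Import GRing.Theory.
Local Open Scope ring_scope.

Definition has_char (R : nzRingType) (c : nat) : Prop :=
  forall n : nat, (n%:R == 0 :> R) = (c %| n)%N.

Section Ideals.
Variable A : finComNzRingType.

(* The improper ideals {0} and A are included, unlike in ring_quotient. *)
Definition ideal (I : {set A}) : bool :=
  [&& 0 \in I,
      [forall a in I, forall b in I, a + b \in I]
    & [forall r, forall a in I, r * a \in I]].

Definition idl1 (a : A) : {set A} := [set u * a | u : A].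
Definition idl2 (a b : A) : {set A} := [set u * a + v * b | u : A, v : A].

Definition maximal_ideal (I : {set A}) : bool :=
  maxset (fun J : {set A} => ideal J && (J != setT)) I.

Definition chain_ring : Prop :=
  forall I J : {set A}, ideal I -> ideal J -> (I \subset J) || (J \subset I).

End Ideals.

Section Polynomials.
Variable R : comNzRingType.
Implicit Types f g : {poly R}.

Definition deg f : nat := (size f).-1.

(* x^(deg f) f(1/x): the coefficients of f in the opposite order. *)
Definition recip f : {poly R} := \poly_(i < size f) f`_(deg f - i).

(* Comaximality: R is not assumed to be a domain, so coprimep is not usable. *)
Definition coprime_poly f g : Prop := exists u v, u * f + v * g = 1.

Definition basic_irreducible (F : fieldType) (pi : {rmorphism R -> F}) f : Prop :=
  irreducible_poly (map_poly pi f).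

End Polynomials.

Definition teichmuller (R : finNzRingType) (z : R) (N : nat) : {set R} :=
  0 |: [set z ^+ i | i : 'I_N].

Section Quotient.
Variable R : finComUnitRingType.
Implicit Types h : {poly R}.

(* R[x]/<h> when deg h > 0 and the leading coefficient of h is a unit: then h
   and its monic associate generate the same ideal. The normalisation is needed
   because {poly %/ h} is R[x]/<'X> when h is not monic, and k^* in general is
   not. *)
Definition polyquo h := {poly %/ (lead_coef h)^-1 *: h}.

HB.instance Definition _ h := GRing.ComNzRing.on (polyquo h).
HB.instance Definition _ h := Finite.on (polyquo h).

Definition cls h (f : {poly R}) : polyquo h := in_qpoly _ f.

(* The representative of degree less than deg h. *)
Definition rep h (c : polyquo h) : {poly R} := polyn c.

Definition polyquo_unit h : {pred polyquo h} := [pred a | [exists b, b * a == 1]].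
Definition polyquo_inv h (a : polyquo h) : polyquo h :=
  odflt a [pick b | b * a == 1].

Fact polyquo_mulVx h : {in @polyquo_unit h, left_inverse 1 (@polyquo_inv h) *%R}.
Proof.
move=> a /existsP[b ba1]; rewrite /polyquo_inv.
by case: pickP => [c /eqP //|/(_ b)]; rewrite ba1.
Qed.

Fact polyquo_unitPl h (a b : polyquo h) : b * a = 1 -> polyquo_unit a.
Proof. by move=> ba1; apply/existsP; exists b; apply/eqP. Qed.

Fact polyquo_invx_out h : {in [predC @polyquo_unit h], @polyquo_inv h =1 id}.
Proof.
move=> a /existsPn na; rewrite /polyquo_inv.
by case: pickP => // b ba1; case/negP: (na b).
Qed.

HB.instance Definition _ h := GRing.ComNzRing_hasMulInverse.Build (polyquo h)
  (@polyquo_mulVx h) (@polyquo_unitPl h) (@polyquo_invx_out h).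

Definition orth (k : {poly R}) (I : {set polyquo k}) : {set polyquo (recip k)} :=
  [set a | [forall c in I, a * cls (recip k) (recip (rep c)) == 0]].

Section Types.
Variables (T : {set R}) (gamma : R) (k f : {poly R}).

Definition expansion (N : nat) (G : {poly R}) : Prop :=
  exists2 a : 'I_N -> {poly R},
    forall i, a i \is a polyOver T /\ (size (a i) <= deg f)%N
    & G = \sum_(i < N) a i * f ^+ i.

Definition zero_or_unit_expansion (N : nat) (G : {poly R}) : Prop :=
  G = 0 \/ (cls k G \is a GRing.unit /\ expansion N G).

Definition gen (omega t : nat) (G : {poly R}) : polyquo k :=
  cls k (f ^+ omega + gamma *: (f ^+ t * G)).

Definition ggen (e : nat) : polyquo k := cls k (gamma *: f ^+ e).

Definition is_kappa (omega t : nat) (G : {poly R}) (kappa : nat) : Prop :=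
  ggen kappa \in idl1 (gen omega t G) /\
  forall e : nat, ggen e \in idl1 (gen omega t G) -> (kappa <= e)%N.

(* q stands for p^s. *)
Definition typeIII (q omega t : nat) (G : {poly R}) : Prop :=
  (0 < omega < q)%N /\
  exists kappa : nat,
    [/\ is_kappa omega t G kappa,
        G != 0 -> (t < kappa)%N
      & zero_or_unit_expansion (kappa - t) G].

Definition typeIV (q omega t mu : nat) (G : {poly R}) : Prop :=
  exists kappa : nat,
    [/\ is_kappa omega t G kappa,
        [/\ (mu < kappa)%N, (kappa <= omega)%N & (omega < q)%N],
        G != 0 -> (t < mu)%N
      & zero_or_unit_expansion (mu - t) G].

(* q stands for p^s. *)
Definition gdecomp (q : nat) (M G : {poly R}) (delta : nat) (A : polyquo k) : Prop :=
  [/\ (delta < q)%N,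
      cls k (gamma *: (M - G)) = cls k (gamma *: f ^+ delta) * A
    & A = 0 \/ A \is a GRing.unit].

End Types.
End Quotient.

(* Main.v *)
Require Import Defs.
From HB Require Import structures.
From mathcomp Require Import all_boot all_order all_algebra.
From mathcomp Require Import qpoly ring zify.

Set Implicit Arguments.
Unset Strict Implicit.
Unset Printing Implicit Defensive.

Import GRing.Theory.
Local Open Scope ring_scope.

(** Write [q = p^s], [K = R[x]/<k>] and [K' = R[x]/<k^*>], for a factor
    [k = f^q + gamma g] of [x^(nq) - lambda].

    The substitution [x |-> 1/x] is a ring isomorphism [phi : K -> K']
    ([reciprocal_isomorphism]), and [c^* = x^(deg c) phi(c)]. As [x] is a unit, the
    orthogonal of an ideal [I] is the image under [phi] of the annihilator of [I]
    ([orth_annihilator]). The powers of [x] in the theorem are those that turn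
    reciprocal polynomials back into images under [phi], up to a unit that is common
    to all the terms of a generator ([twisted_monomial]).

    Annihilators in [K] come from one computation ([annihilator_gen]). It uses only
    that [gamma^2 = 0], that [f^q = - gamma g], and that [K/gamma K = F[x]/<f^q>],
    where [f^(q-a)] generates the annihilator of [f^a] ([cls_torsion]). Multiplying
    [f^omega + gamma h] by [f^(q-omega)] leaves [gamma (f^(q-omega) h - g)]; if this
    defect is [gamma f^mu e] with [mu <= omega], then the annihilator of
    [<f^omega + gamma h, gamma f^mu>] is [<f^(q-mu) - gamma e, gamma f^(q-omega)>].

    The ideals of types II to IV have this form. In type II the first generator is
    [k = 0] itself. In type III the defect is [gamma f^mu e] either with
    [mu >= omega], so that [f^(mu-omega) e] can serve with the exponent [omega], and
    [gamma f^omega] is in the ideal anyway; or with [mu < omega] and [e] a unit, and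
    then [gamma f^mu] is in the ideal, being a multiple of the generator. In type IV
    the minimality of [kappa] bounds [mu] by the exponent of the defect ([kappa_le]).
    What is left is to compute the defect: it is [gamma f^(q-omega+t) G] in
    characteristic [p], where [k = f^q] by uniqueness of coprime factorisations
    ([monic_factor_unique]), and [gamma (f^(q-omega+t) G - f^q1 M)], with
    [q1 = p^(s-1)], in characteristic [p^2]. In the second case the two terms have
    different exponents and the smaller one wins, unless [omega = q - q1 + t], when
    the defect is [- gamma f^q1 (M - G) = - gamma f^(q1+delta) A]. *)

(** * Ideals with one or two generators *)

Section IdealLemmas.
Variable A : finComUnitRingType.
Implicit Types (a b c u v y : A) (I : {set A}).

Definition annihilator I : {set A} := [set y | [forall c in I, y * c == 0]].

Lemma idl1P y a : reflect (exists u, y = u * a) (y \in idl1 a).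
Proof.
by apply: (iffP imsetP) => [[u _ ->]|[u ->]]; exists u.
Qed.

Lemma idl2P y a b : reflect (exists u v, y = u * a + v * b) (y \in idl2 a b).
Proof.
apply: (iffP imset2P) => [[u v _ _ ->]|[u [v ->]]]; first by exists u, v.
by exists u v.
Qed.

Lemma idl1_idl2 a b : b \in idl1 a -> idl1 a = idl2 a b.
Proof.
case/idl1P=> c ->; apply/setP => y; apply/idl1P/idl2P => [[u ->]|[u [v ->]]].
  by exists u, 0; ring.
by exists (u + v * c); ring.
Qed.

Lemma idl2_unit u v a b : u \is a GRing.unit -> v \is a GRing.unit ->
  idl2 (u * a) (v * b) = idl2 a b.
Proof.
move=> uU vU; apply/setP => y; apply/idl2P/idl2P => -[c [d ->]].
  by exists (c * u), (d * v); ring.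
by exists (c / u), (d / v); rewrite mulrA divrK // mulrA divrK.
Qed.

Lemma idl2_addl a b c : idl2 (a + c * b) b = idl2 a b.
Proof.
apply/setP => y; apply/idl2P/idl2P => -[u [v ->]].
  by exists u, (u * c + v); ring.
by exists u, (v - u * c); ring.
Qed.

Lemma annihilator_idl2 y a b :
  (y \in annihilator (idl2 a b)) = (y * a == 0) && (y * b == 0).
Proof.
rewrite inE; apply/forall_inP/andP => [ann0|[/eqP ya0 /eqP yb0] c].
  by split; apply: ann0; apply/idl2P; [exists 1, 0|exists 0, 1]; ring.
case/idl2P=> u [v ->]; apply/eqP.
by rewrite mulrDr !mulrA ![y * _]mulrC -!mulrA ya0 yb0 !mulr0 addr0.
Qed.

Lemma unitrD_nil u c N : u \is a GRing.unit -> c ^+ N = 0 ->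
  u + c \is a GRing.unit.
Proof.
move=> uU cN0; have: u ^+ N - (- c) ^+ N \is a GRing.unit.
  by rewrite exprNn cN0 mulr0 subr0 unitrX.
by rewrite subrXX opprK unitrM => /andP[].
Qed.

End IdealLemmas.

Section ImageIdeal.
Variables (A B : finComUnitRingType) (phi : {rmorphism A -> B}).
Hypothesis phi_surj : forall z, exists y, z = phi y.

Lemma imset_idl2 a b : phi @: idl2 a b = idl2 (phi a) (phi b).
Proof.
apply/setP => z; apply/imsetP/idl2P => [[y /idl2P[u [v ->]] ->]|[u [v ->]]].
  by exists (phi u), (phi v); rewrite rmorphD !rmorphM.
have [[u' ->] [v' ->]] := (phi_surj u, phi_surj v).
exists (u' * a + v' * b); last by rewrite rmorphD !rmorphM.
by apply/idl2P; exists u', v'.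
Qed.

End ImageIdeal.

(** * Annihilators in a ring where f^q is a multiple of gamma *)

Section ChainRingExtension.
Variables (A : finComUnitRingType) (f gamma w : A) (q : nat).
Hypotheses (gamma2 : gamma ^+ 2 = 0) (fq : f ^+ q = gamma * w).
(* Modulo [gamma], the annihilator of [f ^+ a] is generated by [f ^+ (q - a)]; the
   multiples of [gamma] are a copy of the quotient by [gamma], as the case [a = 0]
   shows with [fq]. *)
Hypothesis torsion : forall a y, (a <= q)%N ->
  gamma * f ^+ a * y = 0 -> exists u v, y = f ^+ (q - a) * u + gamma * v.

Lemma gammaM_fq : gamma * f ^+ q = 0.
Proof. by rewrite fq mulrA -expr2 gamma2 mul0r. Qed.

Section Generator.
Variables (omega mu : nat) (h e : A).
Hypothesis omega_q : (omega <= q)%N.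
(* The left-hand side is the product of [f ^+ (q - omega)] with the generator
   [f ^+ omega + gamma * h], which it kills modulo [gamma]. *)
Hypothesis defect : gamma * (w + f ^+ (q - omega) * h) = gamma * (f ^+ mu * e).

Let gen := f ^+ omega + gamma * h.

Lemma exprM_gen : f ^+ (q - omega) * gen = gamma * (f ^+ mu * e).
Proof.
by rewrite /gen mulrDr -exprD subnK // fq mulrCA -mulrDr.
Qed.

Lemma gammaM_mem_gen : e \is a GRing.unit -> gamma * f ^+ mu \in idl1 gen.
Proof.
move=> eU; apply/idl1P; exists (e^-1 * f ^+ (q - omega)).
by rewrite -mulrA exprM_gen mulrCA [e^-1 * _]mulrC mulrK.
Qed.

(** If [y] annihilates [gamma f^mu] then [y = f^(q-mu) u + gamma v], and the product
    of [y] with [gen] is [gamma f^omega (u e + v)]. It vanishes exactly when [u e + v]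
    is a multiple of [f^(q-omega)] modulo [gamma], and this determines [gamma v]. *)
Lemma annihilator_gen : (mu <= omega)%N ->
  annihilator (idl2 gen (gamma * f ^+ mu)) =
  idl2 (f ^+ (q - mu) - gamma * e) (gamma * f ^+ (q - omega)).
Proof.
move=> mu_omega.
have mu_q : (mu <= q)%N by apply: leq_trans omega_q.
have gam0 : gamma * gamma = 0 by rewrite -expr2.
have gen_mu : f ^+ (q - mu) * gen = gamma * f ^+ omega * e.
  have -> : (q - mu = (omega - mu) + (q - omega))%N by lia.
  rewrite exprD -mulrA exprM_gen -[in RHS](subnK mu_omega) exprD; ring.
have gen_gamma : gamma * gen = gamma * f ^+ omega.
  by rewrite /gen mulrDr mulrA gam0 mul0r addr0.
have fmu : gamma * (f ^+ (q - mu) * f ^+ mu) = 0.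
  by rewrite -exprD subnK // gammaM_fq.
have fom : gamma * (f ^+ (q - omega) * f ^+ omega) = 0.
  by rewrite -exprD subnK // gammaM_fq.
apply/setP => y; rewrite annihilator_idl2.
move: (gen) gen_mu gen_gamma => g gen_mu gen_gamma.
apply/andP/idl2P => [[/eqP y_gen /eqP y_mu]|[u [v ->]]].
  have [u [v def_y]] : exists u v, y = f ^+ (q - mu) * u + gamma * v.
    by apply: (torsion mu_q); rewrite mulrC.
  have /(torsion omega_q)[z [z' def_z]] : gamma * f ^+ omega * (u * e + v) = 0.
    transitivity (u * (f ^+ (q - mu) * g) + v * (gamma * g)).
      by rewrite gen_mu gen_gamma; ring.
    by rewrite -[RHS]y_gen def_y; ring.
  have def_v : v = f ^+ (q - omega) * z + gamma * z' - u * e by rewrite -def_z; ring.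
  exists u, z; rewrite def_y def_v.
  transitivity (u * (f ^+ (q - mu) - gamma * e) + z * (gamma * f ^+ (q - omega))
                + gamma * gamma * z'); first by ring.
  by rewrite gam0 mul0r addr0.
split; apply/eqP.
  transitivity (u * (f ^+ (q - mu) * g - e * (gamma * g))
                + v * f ^+ (q - omega) * (gamma * g)); first by ring.
  rewrite gen_mu gen_gamma.
  transitivity (v * (gamma * (f ^+ (q - omega) * f ^+ omega))); first by ring.
  by rewrite fom mulr0.
transitivity (u * (gamma * (f ^+ (q - mu) * f ^+ mu))
  + gamma * gamma * (v * f ^+ (q - omega) * f ^+ mu - u * e * f ^+ mu)).
  by ring.
by rewrite fmu gam0; ring.
Qed.

End Generator.

Lemma gammaM_omega_mem omega h :
  gamma * f ^+ omega \in idl1 (f ^+ omega + gamma * h).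
Proof.
apply/idl1P; exists gamma.
by rewrite mulrDr mulrA -expr2 gamma2 mul0r addr0.
Qed.

End ChainRingExtension.

(** * Quotients of R[x] and the substitution of 1/x for x *)

HB.instance Definition _ (R : finComUnitRingType) (h : {poly R}) :=
  GRing.RMorphism.copy (@cls R h)
    (in_qpoly ((lead_coef h)^-1 *: h) : {poly R} -> polyquo h).

Arguments rep : simpl never.
Arguments cls : simpl never.

Section PolynomialQuotient.
Variables (R : finComUnitRingType) (h : {poly R}).
Hypotheses (size_h : (1 < size h)%N) (lead_h : lead_coef h \is a GRing.unit).
Implicit Types P Q : {poly R}.

Let hm := (lead_coef h)^-1 *: h.

Lemma size_normalised : size hm = size h.
Proof. by rewrite lreg_size //; apply: mulrI; rewrite unitrV. Qed.

Lemma monic_normalised : hm \is monic.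
Proof.
by apply/monicP; rewrite lead_coefE size_normalised coefZ -lead_coefE mulVr.
Qed.

Lemma mk_monic_normalised : mk_monic hm = hm.
Proof. by rewrite /mk_monic monic_normalised size_normalised size_h. Qed.

Lemma repE P : rep (cls h P) = Pdiv.Ring.rmodp P hm.
Proof. by rewrite /rep /cls /in_qpoly /= mk_monic_normalised. Qed.

Lemma cls_eq0P P : cls h P = 0 <-> exists Q, P = Q * h.
Proof.
split=> [clsP0|[Q ->]].
  have [Q ->] : exists Q, P = Q * hm.
    apply/(Pdiv.RingMonic.rdvdpP monic_normalised).
    by rewrite /Pdiv.Ring.rdvdp -repE clsP0.
  by exists ((lead_coef h)^-1%:P * Q); rewrite /hm -mul_polyC; ring.
have clsh0 : cls h h = 0.
  apply: val_inj; rewrite /= mk_monic_normalised.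
  have -> : h = (lead_coef h)%:P * hm.
    by rewrite mul_polyC scalerA divrr ?scale1r.
  exact: Pdiv.RingMonic.rmodp_mull monic_normalised _.
by rewrite rmorphM /= clsh0 mulr0.
Qed.

Lemma repK (c : polyquo h) : cls h (rep c) = c.
Proof.
apply: val_inj; apply: in_qpoly_small.
apply: leq_ltn_trans (size_npoly c) _.
by rewrite ltn_predL mk_monic_normalised size_normalised ltnW.
Qed.

(** The universal property of [R[x]/<h>]. *)
Lemma polyquo_factor (S : finComUnitRingType) (e : {rmorphism {poly R} -> S}) :
  e h = 0 -> exists phi : {rmorphism polyquo h -> S}, forall P, phi (cls h P) = e P.
Proof.
move=> eh0; pose phi (c : polyquo h) := e (rep c).
have phiE P : phi (cls h P) = e P.
  have /cls_eq0P[Q defQ] : cls h (rep (cls h P) - P) = 0.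
    by rewrite rmorphB /= repK subrr.
  by apply/eqP; rewrite -subr_eq0 -rmorphB defQ rmorphM eh0 mulr0.
have phiD : {morph phi : a b / a - b}.
  move=> a b; rewrite -{1}[a]repK -{1}[b]repK -rmorphB phiE.
  by rewrite rmorphB.
have phiM : monoid_morphism phi.
  split=> [|a b]; first by rewrite -(rmorph1 (cls h)) phiE rmorph1.
  by rewrite -{1}[a]repK -{1}[b]repK -rmorphM phiE rmorphM.
pose phiD' := GRing.isZmodMorphism.Build _ _ phi phiD.
pose phiM' := GRing.isMonoidMorphism.Build _ _ phi phiM.
by exists (HB.pack_for {rmorphism polyquo h -> S} phi phiD' phiM').
Qed.

End PolynomialQuotient.

Lemma poly_morph_ext (R : finComUnitRingType) (S : comNzRingType)
    (e1 e2 : {rmorphism {poly R} -> S}) :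
  (forall c, e1 c%:P = e2 c%:P) -> e1 'X = e2 'X -> e1 =1 e2.
Proof.
move=> eC eX; elim/poly_ind => [|P c IH]; first by rewrite !rmorph0.
by rewrite !rmorphD !rmorphM IH eC eX.
Qed.

Section Reciprocal.
Variable R : finComUnitRingType.
Implicit Types h P Q : {poly R}.

Lemma recipC (c : R) : recip c%:P = c%:P.
Proof.
rewrite /recip /deg; apply/polyP => i; rewrite coef_poly size_polyC.
by case: eqP => [->|_] /=; rewrite ?polyC0 ?coef0 ?coefC //; case: i.
Qed.

Section NonzeroConstantTerm.
Variable h : {poly R}.
Hypothesis h0 : h`_0 != 0.

Lemma size_gt0_coef0 : (0 < size h)%N.
Proof. by case: posnP => // s0; move: h0; rewrite nth_default ?s0 ?eqxx. Qed.

Lemma size_recip : size (recip h) = size h.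
Proof.
rewrite /recip /deg; case: (size h) size_gt0_coef0 => // n _.
by rewrite size_poly_eq //= subnn.
Qed.

Lemma lead_coef_recip : lead_coef (recip h) = h`_0.
Proof.
by rewrite lead_coefE size_recip coef_poly /deg subnn ltn_predL size_gt0_coef0.
Qed.

Lemma coef0_recip : (recip h)`_0 = lead_coef h.
Proof.
rewrite coef_poly subn0 -lead_coefE; case: posnP => // /eqP.
by rewrite size_poly_eq0 => /eqP->; rewrite lead_coef0.
Qed.

Lemma recipK : recip (recip h) = h.
Proof.
rewrite {1}/recip size_recip; apply/polyP => i; rewrite coef_poly.
case: ltnP => [lt_ih|]; last by move=> le; rewrite nth_default.
rewrite coef_poly /deg size_recip.
have -> : ((size h).-1 - i < size h)%N by lia.
by rewrite subKn // -ltnS (ltn_predK lt_ih).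
Qed.

End NonzeroConstantTerm.

Section Unit.
Variable h : {poly R}.
Hypotheses (size_h : (1 < size h)%N) (lead_h : lead_coef h \is a GRing.unit).
Hypothesis h0 : h`_0 \is a GRing.unit.

Lemma polyquo_X_unit : cls h 'X \is a GRing.unit.
Proof.
have [Q defh] : exists Q, h = Q * 'X + (h`_0)%:P.
  exists (\poly_(i < (size h).-1) h`_i.+1); apply/polyP => i.
  rewrite coefD coefMX coefC coef_poly.
  case: i => [|i] /=; first by rewrite add0r.
  by rewrite addr0; case: ltnP => // le; rewrite nth_default //; lia.
have hh0 : cls h h = 0 by apply/(cls_eq0P size_h lead_h); exists 1; rewrite mul1r.
have: cls h (- (h`_0)^-1%:P * Q) * cls h 'X = 1.
  rewrite -[RHS](rmorph1 (cls h)) -rmorphM.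
  have -> : - (h`_0)^-1%:P * Q * 'X = 1 - (h`_0)^-1%:P * h.
    rewrite [X in 1 - _ * X]defh mulrDr -polyCM mulVr //; ring.
  by rewrite rmorphB rmorphM /= hh0 mulr0 subr0.
by rewrite mulrC => inv; apply/unitrPr; eexists; exact: inv.
Qed.

(** Evaluation at [1/x] computes reciprocal polynomials up to a power of [x]. *)
Lemma recip_morphism : exists e : {rmorphism {poly R} -> polyquo h},
  [/\ forall c, e c%:P = cls h c%:P, e 'X = (cls h 'X)^-1
   & forall P, cls h (recip P) = cls h 'X ^+ deg P * e P].
Proof.
have cfu : commr_rmorph (cls h \o polyC) (cls h 'X)^-1 by move=> c; apply: mulrC.
pose e := GRing.RMorphism.clone _ _ (horner_morph cfu) _.
exists e; split=> [c||P]; first exact: horner_morphC; first exact: horner_morphX.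
have -> : e P = \sum_(i < size P) e (P`_i *: 'X^i).
  by rewrite -rmorph_sum -poly_def coefK.
rewrite /recip poly_def rmorph_sum mulr_sumr /=.
rewrite (reindex_inj rev_ord_inj) /=; apply: eq_bigr => i _.
rewrite -!mul_polyC !rmorphM !rmorphXn /=.
have -> : e 'X = (cls h 'X)^-1 by apply: horner_morphX.
have -> : e (P`_i)%:P = cls h (P`_i)%:P by apply: horner_morphC.
have def_s := ltn_predK (ltn_ord i).
have le_i : (i <= deg P)%N by rewrite -ltnS def_s.
have rev_deg : (size P - i.+1 = deg P - i)%N by rewrite subnS predn_sub.
rewrite mulrCA rev_deg subKn //; congr (_ * _).
by rewrite exprVn exprB ?polyquo_X_unit.
Qed.

End Unit.

(** [c |-> c(1/x)] is well defined from [R[x]/<k>] to [R[x]/<k^*>], because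
    [k(1/x)] is [k^*] up to a power of the unit [x]; the same substitution, from
    [R[x]/<k^*>] to [R[x]/<k>], is its inverse. *)
Lemma reciprocal_isomorphism (k : {poly R}) :
    (1 < size k)%N -> lead_coef k \is a GRing.unit -> k`_0 \is a GRing.unit ->
  exists phi : {rmorphism polyquo k -> polyquo (recip k)}, bijective phi /\
    forall P, cls (recip k) (recip P) = cls (recip k) 'X ^+ deg P * phi (cls k P).
Proof.
move=> size_k lead_k k0.
have kn0 : k`_0 != 0 by apply: contraTneq k0 => ->; rewrite unitr0.
have size_k' : (1 < size (recip k))%N by rewrite size_recip.
have lead_k' : lead_coef (recip k) \is a GRing.unit by rewrite lead_coef_recip.
have k0' : (recip k)`_0 \is a GRing.unit by rewrite coef0_recip.
have X_unit := polyquo_X_unit size_k lead_k k0.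
have X_unit' := polyquo_X_unit size_k' lead_k' k0'.
have [e [eC eX eP]] := recip_morphism size_k' lead_k' k0'.
have [e' [eC' eX' eP']] := recip_morphism size_k lead_k k0.
have ek : e k = 0.
  apply: (mulrI (unitrX (deg k) X_unit')); rewrite mulr0 -eP.
  by apply/(cls_eq0P size_k' lead_k'); exists 1; rewrite mul1r.
have ek' : e' (recip k) = 0.
  apply: (mulrI (unitrX (deg (recip k)) X_unit)); rewrite mulr0 -eP' recipK //.
  by apply/(cls_eq0P size_k lead_k); exists 1; rewrite mul1r.
have [phi phiE] := polyquo_factor size_k lead_k ek.
have [psi psiE] := polyquo_factor size_k' lead_k' ek'.
have psi_phi P : psi (phi (cls k P)) = cls k P.
  apply: (@poly_morph_ext _ _ (psi \o phi \o cls k) (cls k)) => [c|] /=.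
    by rewrite phiE eC psiE eC'.
  by rewrite phiE eX rmorphV // psiE eX' invrK.
have phi_psi P : phi (psi (cls (recip k) P)) = cls (recip k) P.
  apply: (@poly_morph_ext _ _ (phi \o psi \o cls _) (cls _)) => [c|] /=.
    by rewrite psiE eC' phiE eC.
  by rewrite psiE eX' rmorphV // phiE eX invrK.
exists phi; split=> [|P]; last by rewrite phiE eP.
exists psi => c; first by rewrite -[c](repK size_k lead_k) psi_phi.
by rewrite -[c](repK size_k' lead_k') phi_psi.
Qed.

End Reciprocal.

Section Orthogonal.
Variables (R : finComUnitRingType) (k : {poly R}).
Hypotheses (size_k : (1 < size k)%N) (lead_k : lead_coef k \is a GRing.unit).
Hypothesis k0 : k`_0 \is a GRing.unit.
Variable phi : {rmorphism polyquo k -> polyquo (recip k)}.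
Hypothesis phi_bij : bijective phi.
Hypothesis phiE : forall P,
  cls (recip k) (recip P) = cls (recip k) 'X ^+ deg P * phi (cls k P).

Lemma recip_X_unit : cls (recip k) 'X \is a GRing.unit.
Proof.
have kn0 : k`_0 != 0 by apply: contraTneq k0 => ->; rewrite unitr0.
by apply: polyquo_X_unit; rewrite ?size_recip ?lead_coef_recip ?coef0_recip.
Qed.

(** [c^*] and [phi c] differ by a power of the unit [x]. *)
Lemma orth_annihilator (I : {set polyquo k}) : orth I = phi @: annihilator I.
Proof.
have [psi phiK psiK] := phi_bij.
apply/setP => a; rewrite -[a]psiK mem_imset ?inE; last exact: bij_inj.
apply: eq_forallb_in => c _; rewrite phiE repK // mulrCA -rmorphM.
rewrite -[0 in LHS](mulr0 (cls (recip k) 'X ^+ deg (rep c))).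
rewrite (inj_eq (mulrI (unitrX _ recip_X_unit))).
by rewrite -[0 in LHS](rmorph0 phi) (inj_eq (bij_inj phi_bij)).
Qed.

Lemma orth_set0 : orth [set 0 : polyquo k] = setT.
Proof.
have [psi _ psiK] := phi_bij.
rewrite orth_annihilator; apply/setP => a; rewrite inE -[a]psiK; apply: imset_f.
by rewrite inE; apply/forall_inP => c /set1P->; rewrite mulr0.
Qed.

Lemma orth_setT : orth (setT : {set polyquo k}) = [set 0].
Proof.
rewrite orth_annihilator.
have -> : annihilator setT = [set 0 : polyquo k].
  apply/setP => a; rewrite !inE; apply/forall_inP/eqP => [ann_a|-> c _].
    by apply/eqP; rewrite -[a]mulr1 ann_a ?inE.
  by rewrite mul0r.
by rewrite imset_set1 rmorph0.
Qed.

End Orthogonal.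

(** * Reduction to the residue field *)

Section Comaximal.
Variable R : comNzRingType.
Implicit Types P Q S : {poly R}.

Lemma coprime_poly_sym P Q : coprime_poly P Q -> coprime_poly Q P.
Proof. by case=> u [v uv]; exists v, u; rewrite addrC. Qed.

Lemma coprime_polyM P Q S :
  coprime_poly P Q -> coprime_poly P S -> coprime_poly P (Q * S).
Proof.
case=> u [v uv] [u' [v' uv']].
exists (u * (u' * P + v' * S) + v * Q * u'), (v * v').
by rewrite -[RHS]mulr1 -{1}uv -{1}uv'; ring.
Qed.

Lemma coprime_poly_prod (J : Type) (r : seq J) (B : pred J) (E : J -> {poly R}) P :
  (forall i, B i -> coprime_poly P (E i)) ->
  coprime_poly P (\prod_(i <- r | B i) E i).
Proof.
move=> cop; elim/big_ind: _ => //; first by exists 0, 1; rewrite mul0r mul1r add0r.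
by move=> Q S; apply: coprime_polyM.
Qed.

Lemma coprime_poly_exp P Q a b :
  coprime_poly P Q -> coprime_poly (P ^+ a) (Q ^+ b).
Proof.
have expr_r S T N : coprime_poly S T -> coprime_poly S (T ^+ N).
  by move=> ST; rewrite -[N]subn0 -prodr_const_nat; apply: coprime_poly_prod.
by move=> PQ; apply/expr_r/coprime_poly_sym/expr_r/coprime_poly_sym.
Qed.

End Comaximal.

Section ResidueField.
Variables (R : finComUnitRingType) (F : fieldType) (pi : {rmorphism R -> F}).
Variable gamma : R.
Hypotheses (pi_surj : forall y, exists x, pi x = y)
  (pi_ker : forall x, (pi x == 0) = (x \in idl1 gamma)).
Hypotheses (gamma_neq0 : gamma != 0) (gamma2 : gamma ^+ 2 = 0).
Implicit Types P Q S : {poly R}.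

Local Notation "P ^pi" := (map_poly pi P) (at level 2).

Lemma pi_gamma : pi gamma = 0.
Proof. by apply/eqP; rewrite pi_ker; apply/idl1P; exists 1; rewrite mul1r. Qed.

(** An element outside the kernel of [pi] is a unit modulo [gamma], so it cannot
    kill [gamma]. *)
Lemma gammaM_eq0 c : gamma * c = 0 -> pi c = 0.
Proof.
move=> gc0; apply/eqP/negPn/negP => pic_n0.
have [c' pic'] := pi_surj (pi c)^-1.
have : pi (c * c' - 1) == 0 by rewrite rmorphB rmorphM rmorph1 pic' divff ?subrr.
rewrite pi_ker => /idl1P[v def_v]; case/eqP: gamma_neq0.
rewrite -[LHS]mulr1 -[1](subrK (c * c')) -opprB def_v.
by rewrite mulrDr mulrN mulrCA -expr2 gamma2 mulr0 oppr0 add0r mulrA gc0 mul0r.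
Qed.

Lemma map_poly_pi_eq0 P : P^pi = 0 -> exists Q, P = gamma *: Q.
Proof.
move=> P0.
have div i : exists v, P`_i == gamma * v.
  have /idl1P[v ->] : P`_i \in idl1 gamma.
    by rewrite -pi_ker -coef_map P0 coef0.
  by exists v; rewrite mulrC.
exists (\poly_(i < size P) xchoose (div i)); apply/polyP => i.
rewrite coefZ coef_poly; case: ltnP => [_|le]; first exact/eqP/(xchooseP (div i)).
by rewrite nth_default // mulr0.
Qed.

Lemma scale_gamma_eq0 P : gamma *: P = 0 -> P^pi = 0.
Proof.
move=> P0; apply/polyP => i; rewrite coef_map coef0 /=.
by apply: gammaM_eq0; rewrite -coefZ P0 coef0.
Qed.

Lemma map_poly_pi_gamma P : (gamma *: P)^pi = 0.
Proof. by rewrite map_polyZ /= pi_gamma scale0r. Qed.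

Lemma map_poly_pi_surj (Q : {poly F}) : exists P, P^pi = Q.
Proof.
have lift y : exists x, pi x == y by have [x <-] := pi_surj y; exists x.
exists (\poly_(i < size Q) xchoose (lift Q`_i)); apply/polyP => i.
rewrite coef_map coef_poly; case: ltnP => [_|le].
  exact/eqP/(xchooseP (lift Q`_i)).
by rewrite /= rmorph0 nth_default.
Qed.

Lemma map_poly_pi_eq P Q : P^pi = Q^pi -> exists S, P = Q + gamma *: S.
Proof.
move=> PQ; have [S defS] : exists S, P - Q = gamma *: S.
  by apply: map_poly_pi_eq0; rewrite rmorphB /= PQ subrr.
by exists S; rewrite -defS addrC subrK.
Qed.

Lemma size_map_poly_monic P : P \is monic -> size (P^pi) = size P.
Proof.
move=> /monicP lead1; apply: size_map_poly_id0.
by rewrite lead1 rmorph1 oner_eq0.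
Qed.

Section ChainQuotient.
Variables (k f g : {poly R}) (q : nat).
Hypotheses (defk : k = f ^+ q + gamma *: g) (q_gt0 : (0 < q)%N).
Hypotheses (k_monic : k \is monic) (f_irr : basic_irreducible pi f).

Local Notation c := (cls k).

Lemma map_poly_pi_k : k^pi = f^pi ^+ q.
Proof. by rewrite defk rmorphD /= map_poly_pi_gamma addr0 rmorphXn. Qed.

Lemma size_k_gt1 : (1 < size k)%N.
Proof.
rewrite -size_map_poly_monic // map_poly_pi_k.
have [f_gt1 _] := f_irr.
by rewrite -subn_gt0 subn1 size_exp muln_gt0 q_gt0 andbT -subn1 subn_gt0.
Qed.

Lemma lead_k_unit : lead_coef k \is a GRing.unit.
Proof. by rewrite (monicP k_monic) unitr1. Qed.

Local Notation cls0P := (cls_eq0P size_k_gt1 lead_k_unit).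

Lemma cls_f_expr : c f ^+ q = c gamma%:P * - c g.
Proof.
have k0 : c k = 0 by apply/cls0P; exists 1; rewrite mul1r.
apply/eqP; rewrite mulrN -addr_eq0 -rmorphXn -(rmorphM (cls k)) -rmorphD mul_polyC -defk.
exact/eqP.
Qed.

Lemma cls_gamma_expr2 : c gamma%:P ^+ 2 = 0.
Proof. by rewrite -rmorphXn -polyC_exp gamma2 polyC0 rmorph0. Qed.

(** In [gamma f^a Y = Q k] the factor [Q] is a multiple [gamma Q'], as [F[x]] is a
    domain; then [f^a Y = Q' f^q] over [F], where [f^a] can be cancelled. *)
Lemma cls_torsion a y : (a <= q)%N -> c gamma%:P * c f ^+ a * y = 0 ->
  exists u v, y = c f ^+ (q - a) * u + c gamma%:P * v.
Proof.
move=> a_q; rewrite -[y](repK size_k_gt1 lead_k_unit); move: (rep y) => Y.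
move=> clsY0; have /cls0P[Q defQ] : c (gamma *: (f ^+ a * Y)) = 0.
  by rewrite -mul_polyC !rmorphM rmorphXn /= mulrA.
have f_neq0 : f^pi != 0.
  by have [f_gt1 _] := f_irr; rewrite -size_poly_gt0 ltnW.
have [Q' defQ'] : exists Q', Q = gamma *: Q'.
  apply: map_poly_pi_eq0; have := congr1 (map_poly pi) defQ.
  rewrite map_poly_pi_gamma rmorphM /= map_poly_pi_k => /esym/eqP.
  by rewrite mulf_eq0 expf_eq0 (negPf f_neq0) andbF orbF => /eqP.
have : (f ^+ a * Y - Q' * k)^pi = 0.
  apply: scale_gamma_eq0; rewrite scalerBr defQ defQ' -scalerAl subrr //.
rewrite rmorphB !rmorphM /= map_poly_pi_k rmorphXn /= -{1}(subnK a_q) exprD => /eqP.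
rewrite mulrA mulrC -mulrBl mulf_eq0 expf_eq0 (negPf f_neq0) andbF orbF.
rewrite subr_eq0 => /eqP Y_mod.
have [S ->] : exists S, Y = f ^+ (q - a) * Q' + gamma *: S.
  by apply: map_poly_pi_eq; rewrite Y_mod rmorphM rmorphXn mulrC.
exists (c Q'), (c S).
by rewrite -mul_polyC rmorphD !rmorphM rmorphXn.
Qed.

(** A Bezout relation with [f] modulo [gamma] is enough, because [f] and [gamma] are
    nilpotent in the quotient. *)
Lemma cls_unit P u v S : u * P + v * f = 1 + gamma *: S ->
  c P \is a GRing.unit.
Proof.
move=> bezout.
have f_nil : c f ^+ (q * 2) = 0.
  by rewrite exprM cls_f_expr exprMn cls_gamma_expr2 mul0r.
have def_uP : c u * c P = 1 + c gamma%:P * c S - c v * c f.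
  apply/eqP; rewrite eq_sym subr_eq -!(rmorphM (cls k)) -rmorphD bezout.
  by rewrite rmorphD rmorph1 -mul_polyC.
have: c u * c P \is a GRing.unit.
  rewrite def_uP; apply: (@unitrD_nil _ _ _ (q * 2)).
    apply: (@unitrD_nil _ _ _ 2); first exact: unitr1.
    by rewrite exprMn cls_gamma_expr2 mul0r.
  by rewrite -mulNr exprMn f_nil mulr0.
by rewrite unitrM => /andP[].
Qed.

Lemma coprime_cls_unit P : coprime_poly P f -> c P \is a GRing.unit.
Proof. by case=> u [v uv]; apply: (@cls_unit P u v 0); rewrite scaler0 addr0. Qed.

(** Divide [P - Q] by [f] modulo [gamma] until the cofactor is prime to [f], hence a
    unit, or until [f ^+ q] has been taken out, and [gamma (P - Q)] vanishes. *)
Lemma gdecomp_exists P Q : exists delta (A : polyquo k),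
  gdecomp gamma f q P Q delta A.
Proof.
rewrite /gdecomp; move: (P - Q) => Y.
have div N : (exists Z, Y^pi = f^pi ^+ N * Z) \/
    exists delta Z, [/\ (delta < N)%N, Y^pi = f^pi ^+ delta * Z & ~~ (f^pi %| Z)].
  elim: N => [|N [[Z defZ]|[delta [Z [lt defZ ndvd]]]]].
  - by left; exists Y^pi; rewrite expr0 mul1r.
  - have [/dvdpP[Z' defZ']|ndvd] := boolP (f^pi %| Z).
      by left; exists Z'; rewrite defZ defZ' exprSr -mulrA [f^pi * _]mulrC.
    by right; exists N, Z.
  by right; exists delta, Z; rewrite ltnW.
have gammaE e Z : Y^pi = f^pi ^+ e * Z^pi ->
    c (gamma *: Y) = c (gamma *: f ^+ e) * c Z.
  move=> defY; have [S ->] : exists S, Y = f ^+ e * Z + gamma *: S.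
    by apply: map_poly_pi_eq; rewrite rmorphM rmorphXn.
  rewrite scalerDr scalerA -expr2 gamma2 scale0r addr0.
  by rewrite -(rmorphM (cls k)) -scalerAl.
have [[Z0 defZ]|[delta [Z0 [lt defZ ndvd]]]] := div q.
  have [Z defZ0] := map_poly_pi_surj Z0.
  exists 0%N, 0; split=> //; last by left.
  rewrite mulr0 (gammaE q Z) ?defZ0 // -mul_polyC rmorphM rmorphXn /=.
  by rewrite cls_f_expr mulrA -expr2 cls_gamma_expr2 !mul0r.
have [Z defZ0] := map_poly_pi_surj Z0.
exists delta, (c Z); split=> //; first by apply: gammaE; rewrite defZ0.
right; move: ndvd; rewrite -irreducible_poly_coprime // coprimep_sym.
case/Bezout_eq1_coprimepP => -[u0 v0] /= bezout.
have [[u defu] [v defv]] := (map_poly_pi_surj u0, map_poly_pi_surj v0).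
have [S defS] : exists S, u * Z + v * f = 1 + gamma *: S.
  by apply: map_poly_pi_eq; rewrite rmorphD !rmorphM rmorph1 /= defu defv defZ0.
exact: cls_unit defS.
Qed.

End ChainQuotient.

(** Coprime factorisations lift uniquely: [k j] is comaximal with the [f i ^+ q],
    [i != j], being congruent to [f j ^+ q] modulo the nilpotent [gamma], hence it
    divides [f j ^+ q]. *)
Lemma monic_factor_unique (r : nat) (f k g : 'I_r -> {poly R}) (q : nat) :
    (forall i, f i \is monic) ->
    (forall i i', i != i' -> coprime_poly (f i) (f i')) ->
    (forall i, k i = f i ^+ q + gamma *: g i) -> (forall i, k i \is monic) ->
    \prod_i k i = \prod_i f i ^+ q ->
  forall j, k j = f j ^+ q.
Proof.
move=> f_monic f_cop k_def k_monic eq_prod j.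
pose B := \prod_(i | i != j) f i ^+ q.
have [u [v uv]] : coprime_poly (f j ^+ q) B.
  by apply: coprime_poly_prod => i ne; apply/coprime_poly_exp/f_cop; rewrite eq_sym.
move: eq_prod; rewrite (bigD1 j) //= [in RHS](bigD1 j) //= -/B.
set C := \prod_(i | _) k i => eq_prod.
have gam0 : gamma%:P * gamma%:P = 0 :> {poly R}.
  by rewrite -polyCM -expr2 gamma2 polyC0.
have [D defD] : exists D, f j ^+ q = k j * D.
  (* [e] is the inverse of the combination of [k j] and [B] that is [1] modulo
     [gamma]. *)
  pose e := 1 - gamma%:P * (u * g j).
  exists (e * (u * f j ^+ q + v * C)).
  have e_k : e * (u * k j + v * B) = 1.
    transitivity (e * (1 + gamma%:P * (u * g j))).
      by rewrite k_def -uv -mul_polyC; ring.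
    transitivity (1 - gamma%:P * gamma%:P * (u * g j) ^+ 2); first by rewrite /e; ring.
    by rewrite gam0; ring.
  transitivity (e * (u * k j * f j ^+ q + v * (f j ^+ q * B))).
    by rewrite -[LHS]mulr1 -e_k; ring.
  by rewrite -eq_prod; ring.
have fq_monic : f j ^+ q \is monic by rewrite monic_exp.
have eq_size : size (f j ^+ q) = size (k j).
  by rewrite -!size_map_poly_monic // k_def rmorphD /= map_poly_pi_gamma addr0.
have D_monic : D \is monic by rewrite -(monicMl _ (k_monic j)) -defD.
have : size D = 1%N.
  move: eq_size; rewrite defD size_Mmonic ?monic_neq0 //.
  have := monic_neq0 (k_monic j); rewrite -size_poly_gt0.
  have := monic_neq0 D_monic; rewrite -size_poly_gt0; lia.
move/eqP/size_poly1P => [d dn0 defDd]; rewrite defD defDd.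
move: D_monic; rewrite defDd monicE lead_coefC => /eqP->.
by rewrite polyC1 mulr1.
Qed.

End ResidueField.

(** * Orthogonals of the ideals of each type *)

Local Ltac nat_lia :=
  repeat match goal with
    | H : ?P |- _ =>
      lazymatch P with
      | nat => fail
      | is_true (leq _ _) => fail
      | @eq nat _ _ => fail
      | is_true (_ != _ :> nat) => fail
      | _ => clear H
      end
  end; lia.

Section Duality.
Variables (R : finComUnitRingType) (F : fieldType) (pi : {rmorphism R -> F}).
Variable gamma : R.
Hypotheses (pi_surj : forall y, exists x, pi x = y)
  (pi_ker : forall x, (pi x == 0) = (x \in idl1 gamma)).
Hypotheses (gamma_neq0 : gamma != 0) (gamma2 : gamma ^+ 2 = 0).
Variables (k f : {poly R}) (q : nat) (g : {poly R}).
Hypotheses (q_gt0 : (0 < q)%N) (k_monic : k \is monic).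
Hypotheses (f_irr : basic_irreducible pi f) (k0 : k`_0 \is a GRing.unit).
Variable phi : {rmorphism polyquo k -> polyquo (recip k)}.
Hypothesis phi_bij : bijective phi.
Hypothesis phiE : forall P,
  cls (recip k) (recip P) = cls (recip k) 'X ^+ deg P * phi (cls k P).
Hypothesis defk : k = f ^+ q + gamma *: g.
Implicit Types (P G E : {poly R}) (omega t mu : nat).

Local Notation bar P := (cls (recip k) (recip P)).
Local Notation x := (cls (recip k) 'X).
Local Notation fs := (bar f).
Local Notation gm := (cls (recip k) gamma%:P).
Local Notation d := (deg f).
Local Notation gen := (gen gamma k f).
Local Notation ggen := (ggen gamma k f).

Let size_k : (1 < size k)%N. Proof. exact: size_k_gt1 defk q_gt0 k_monic f_irr. Qed.
Let lead_k : lead_coef k \is a GRing.unit. Proof. exact: lead_k_unit. Qed.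
Let x_unit : x \is a GRing.unit. Proof. exact: recip_X_unit. Qed.
Let cgamma2 : cls k gamma%:P ^+ 2 = 0. Proof. exact: cls_gamma_expr2. Qed.
Let cfq : cls k f ^+ q = cls k gamma%:P * - cls k g.
Proof. exact: cls_f_expr defk q_gt0 k_monic f_irr. Qed.

Let torsion a y : (a <= q)%N -> cls k gamma%:P * cls k f ^+ a * y = 0 ->
  exists u v, y = cls k f ^+ (q - a) * u + cls k gamma%:P * v.
Proof. by move=> a_q; apply: (cls_torsion pi_surj pi_ker _ _ defk). Qed.

Lemma phi_gamma : gm = phi (cls k gamma%:P).
Proof.
have := phiE gamma%:P; rewrite recipC => ->.
have -> : deg gamma%:P = 0%N by rewrite /deg size_polyC; case: eqP.
by rewrite mul1r.
Qed.

Lemma genE omega t G : gen omega t G =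
  cls k f ^+ omega + cls k gamma%:P * cls k (f ^+ t * G).
Proof. by rewrite /Defs.gen -mul_polyC rmorphD rmorphM /= rmorphXn. Qed.

Lemma ggenE e : ggen e = cls k gamma%:P * cls k f ^+ e.
Proof. by rewrite /Defs.ggen -mul_polyC rmorphM /= rmorphXn. Qed.

(** The exponent of [x] makes [f^* ^ e P^*] homogeneous: after substitution of [1/x],
    the power of [x] left in front depends on [N] only, so that terms with the same
    [N] add up to a unit times an image under [phi]. *)
Lemma twisted_monomial a b e N P : (a + e = b + N)%N ->
  x ^ ((d * a)%N%:Z - (d * b)%N%:Z - (deg P)%:Z) * fs ^+ e * bar P =
  x ^+ (d * N) * phi (cls k (f ^+ e * P)).
Proof.
have -> : phi (cls k (f ^+ e * P)) = phi (cls k f) ^+ e * phi (cls k P).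
  by rewrite !rmorphM !rmorphXn.
move=> eq_ab; rewrite !phiE exprMn -exprM.
transitivity (x ^ ((d * a)%N%:Z - (d * b)%N%:Z - (deg P)%:Z)
    * x ^ (d * e)%N%:Z * x ^ (deg P)%:Z * (phi (cls k f) ^+ e * phi (cls k P))).
  by rewrite -!exprnP; ring.
rewrite -!exprzDr // (exprnP x (d * N)); congr (x ^ _ * _).
move/(congr1 (muln d)): eq_ab; rewrite !mulnDr; nat_lia.
Qed.

Lemma exprM_gen_cls omega t G mu E :
    cls k (gamma *: (f ^+ (q - omega + t) * G - g)) = ggen mu * cls k E ->
  cls k gamma%:P * (- cls k g + cls k f ^+ (q - omega) * cls k (f ^+ t * G)) =
  cls k gamma%:P * (cls k f ^+ mu * cls k E).
Proof.
move=> defect; rewrite [RHS]mulrA -ggenE -defect exprD -mulrA; move: (f ^+ t * G) => h.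
have -> : gamma *: (f ^+ (q - omega) * h - g) = gamma%:P * (f ^+ (q - omega) * h - g).
  by rewrite mul_polyC.
by rewrite rmorphM rmorphB rmorphM rmorphXn addrC.
Qed.

Section Defect.
Variables (omega t mu : nat) (G E : {poly R}).
Hypothesis omega_q : (omega <= q)%N.
Hypothesis defect :
  cls k (gamma *: (f ^+ (q - omega + t) * G - g)) = ggen mu * cls k E.

Lemma ggen_mem_gen : cls k E \is a GRing.unit ->
  ggen mu \in idl1 (gen omega t G).
Proof.
move=> E_unit; rewrite ggenE genE.
by have := gammaM_mem_gen cfq omega_q (exprM_gen_cls defect) E_unit.
Qed.

Variable Es : polyquo (recip k).
Hypothesis defEs : Es = x ^+ (d * (q - mu)) * phi (cls k E).
Hypothesis mu_omega : (mu <= omega)%N.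

(** The image under [phi] of the annihilator, whose generators are then rescaled by
    powers of [x] to involve [f^*] in place of [phi f]. *)
Lemma orth_gen_ggen : orth (idl2 (gen omega t G) (ggen mu)) =
  idl2 (fs ^+ (q - mu) - gm * Es) (gm * fs ^+ (q - omega)).
Proof.
rewrite (orth_annihilator size_k lead_k k0 phi_bij phiE) ggenE genE.
rewrite (annihilator_gen cgamma2 cfq _ omega_q (exprM_gen_cls defect)) //.
rewrite imset_idl2; last by have [psi _ psiK] := phi_bij => z; exists (psi z).
rewrite -(@idl2_unit _ (x ^+ (d * (q - mu))) (x ^+ (d * (q - omega)))) ?unitrX //.
congr (idl2 _ _).
  by rewrite rmorphB rmorphM rmorphXn /= -phi_gamma defEs phiE exprMn -exprM; ring.
by rewrite rmorphM rmorphXn /= -phi_gamma phiE exprMn -exprM; ring.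
Qed.

End Defect.

Lemma idl1_gen omega t G :
  idl1 (gen omega t G) = idl2 (gen omega t G) (ggen omega).
Proof. by apply: idl1_idl2; rewrite ggenE genE; apply: gammaM_omega_mem. Qed.

(** As [gamma f^omega] belongs to [<f^omega + gamma h>], and [gamma f^(q-omega)] to
    [<f^(q-omega) - gamma e>], both pairs of generators reduce to the first
    one when [mu = omega]. *)
Lemma orth_gen omega t G E Es : (omega <= q)%N ->
    cls k (gamma *: (f ^+ (q - omega + t) * G - g)) = ggen omega * cls k E ->
    Es = x ^+ (d * (q - omega)) * phi (cls k E) ->
  orth (idl1 (gen omega t G)) = idl1 (fs ^+ (q - omega) - gm * Es).
Proof.
move=> omega_q defect defEs.
rewrite idl1_gen (orth_gen_ggen omega_q defect defEs) // -idl1_idl2 //.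
rewrite -mulrN; apply: gammaM_omega_mem.
by rewrite phi_gamma -rmorphXn cgamma2 rmorph0.
Qed.

(** Here [gamma f^mu] is a multiple of the generator, because the cofactor of the
    defect is a unit. *)
Lemma orth_gen_unit omega t mu G E Es : (omega <= q)%N -> (mu <= omega)%N ->
    cls k (gamma *: (f ^+ (q - omega + t) * G - g)) = ggen mu * cls k E ->
    cls k E \is a GRing.unit -> Es = x ^+ (d * (q - mu)) * phi (cls k E) ->
  orth (idl1 (gen omega t G)) =
  idl2 (fs ^+ (q - mu) - gm * Es) (gm * fs ^+ (q - omega)).
Proof.
move=> omega_q mu_omega defect E_unit defEs.
by rewrite (idl1_idl2 (ggen_mem_gen omega_q defect E_unit)); apply: orth_gen_ggen defEs _.
Qed.

(** [gamma f^tau] together with [k], which is a generator with [omega = q] and with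
    the defect [0], but is [0] in the quotient. *)
Lemma orth_ggen tau : (tau <= q)%N ->
  orth (idl1 (ggen tau)) = idl2 (fs ^+ (q - tau)) gm.
Proof.
move=> tau_q.
have defect : cls k (gamma *: (f ^+ (q - q + 0) * g - g)) = ggen tau * cls k 0.
  by rewrite subnn mul1r subrr scaler0 !rmorph0 mulr0.
have gen0 : gen q 0 g = 0.
  by rewrite /Defs.gen mul1r -defk; apply/(cls_eq0P size_k lead_k); exists 1; rewrite mul1r.
have -> : idl1 (ggen tau) = idl2 (gen q 0 g) (ggen tau).
  rewrite gen0; apply/setP => y; apply/idl1P/idl2P => [[u ->]|[u [v ->]]].
    by exists 0, u; rewrite mulr0 add0r.
  by exists v; rewrite mulr0 add0r.
rewrite (orth_gen_ggen (leqnn q) defect (Es := 0)) ?rmorph0 ?mulr0 //.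
by rewrite subr0 subnn expr0 mulr1.
Qed.

Lemma cls_unitD_f P Q e : cls k P \is a GRing.unit -> (0 < e)%N ->
  cls k (P + f ^+ e * Q) \is a GRing.unit.
Proof.
move=> P_unit e_gt0; rewrite rmorphD rmorphM rmorphXn /=.
apply: (@unitrD_nil _ _ _ (q * 2)) => //.
rewrite exprMn -exprM mulnC exprM.
have -> : cls k f ^+ (q * 2) = 0 by rewrite exprM cfq exprMn cgamma2 mul0r.
by rewrite expr0n eqn0Ngt e_gt0 mul0r.
Qed.

(** The defect is a multiple of the generator, so a unit cofactor puts its power of
    [f] among those over which [kappa] is minimal. *)
Lemma kappa_le omega t mu G E kappa : (omega <= q)%N ->
    is_kappa gamma k f omega t G kappa ->
    cls k (gamma *: (f ^+ (q - omega + t) * G - g)) = ggen mu * cls k E ->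
    cls k E \is a GRing.unit -> (kappa <= mu)%N.
Proof.
by move=> omega_q [_ kappa_min] defect E_unit; apply/kappa_min/ggen_mem_gen/E_unit.
Qed.

Local Notation xz a b P := (x ^ ((d * a)%N%:Z - (d * b)%N%:Z - (deg P)%:Z)).

Section CharacteristicP.
Hypothesis g0 : g = 0.

Lemma defect_p a mu e G : (mu + e = a)%N ->
  cls k (gamma *: (f ^+ a * G - g)) = ggen mu * cls k (f ^+ e * G).
Proof.
move=> <-; rewrite g0 subr0 exprD -mulrA scalerAl.
exact: rmorphM.
Qed.

Lemma defect_p0 a mu : cls k (gamma *: (f ^+ a * 0 - g)) = ggen mu * cls k 0.
Proof. by rewrite g0 subr0 mulr0 scaler0 !rmorph0 mulr0. Qed.

Lemma orth_typeIII_p omega t G : (omega <= q)%N ->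
    (G != 0 -> cls k G \is a GRing.unit) ->
  [/\ G = 0 -> orth (idl1 (gen omega t G)) = idl1 (fs ^+ (q - omega)),
      G != 0 -> (2 * omega <= q + t)%N ->
        orth (idl1 (gen omega t G)) =
        idl1 (fs ^+ (q - omega)
              - gm * xz omega t G * fs ^+ (q + t - 2 * omega) * bar G)
    & G != 0 -> (q + t < 2 * omega)%N ->
        orth (idl1 (gen omega t G)) =
        idl2 (fs ^+ (omega - t) - gm * xz omega t G * bar G)
             (gm * fs ^+ (q - omega))].
Proof.
move=> omega_q G_unit; split=> [->|Gn0 le_omega|Gn0 lt_omega].
- rewrite (orth_gen omega_q (defect_p0 _ _) (Es := 0)) ?rmorph0 ?mulr0 //.
  by rewrite subr0.
- rewrite (orth_gen omega_q (@defect_p _ _ (q + t - 2 * omega) _ _)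
    (@twisted_monomial omega t _ (q - omega) _ _)); try by nat_lia.
  by congr (idl1 _); ring.
rewrite (@orth_gen_unit _ _ (q + t - omega) _ _ _ omega_q _ (@defect_p _ _ 0 _ _) _
    (@twisted_monomial omega t 0 (q - (q + t - omega)) _ _)) ?mul1r ?G_unit //; try by nat_lia.
rewrite expr0 mulr1 mulrA; congr (idl2 (fs ^+ _ - _) _); nat_lia.
Qed.

Lemma orth_typeIV_p omega t mu kappa G : (omega <= q)%N ->
    is_kappa gamma k f omega t G kappa -> (mu < kappa)%N -> (kappa <= omega)%N ->
    (G != 0 -> cls k G \is a GRing.unit) ->
  (G = 0 -> orth (idl2 (gen omega t G) (ggen mu)) =
            idl2 (fs ^+ (q - mu)) (gm * fs ^+ (q - omega))) /\
  (G != 0 -> orth (idl2 (gen omega t G) (ggen mu)) =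
             idl2 (fs ^+ (q - mu)
                   - gm * xz omega t G * fs ^+ (q + t - mu - omega) * bar G)
                  (gm * fs ^+ (q - omega))).
Proof.
move=> omega_q kappaP mu_kappa kappa_omega G_unit.
have mu_omega : (mu <= omega)%N by nat_lia.
split=> [->|Gn0].
  rewrite (orth_gen_ggen omega_q (defect_p0 _ _) (Es := 0)) ?rmorph0 ?mulr0 //.
  by rewrite subr0.
have kappa_eps : (kappa <= q - omega + t)%N.
  apply: (kappa_le omega_q kappaP (@defect_p _ _ 0 _ _)); first exact: addn0.
  by rewrite mul1r G_unit.
rewrite (orth_gen_ggen omega_q (@defect_p _ _ (q + t - mu - omega) _ _)
  (@twisted_monomial omega t _ (q - mu) _ _)) //; try by nat_lia.
by congr (idl2 _ _); ring.
Qed.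

End CharacteristicP.

Section CharacteristicPSquared.
Variables (q1 : nat) (M : {poly R}).
Hypotheses (q1_q : (q1 <= q)%N) (gM : g = f ^+ q1 * M).
Hypothesis M_unit : cls k M \is a GRing.unit.

Lemma defect_p2 a mu e e' G : (mu + e = a)%N -> (mu + e' = q1)%N ->
  cls k (gamma *: (f ^+ a * G - g)) =
  ggen mu * cls k (f ^+ e * G - f ^+ e' * M).
Proof.
move=> <- eq_q1; rewrite gM -eq_q1 !exprD -!mulrA -mulrBr scalerAl.
exact: rmorphM.
Qed.

Lemma twistedM_monomial e e' omega t N G : (omega + e = t + N)%N ->
    (q + e' = q1 + N)%N ->
  xz omega t G * fs ^+ e * bar G - xz q q1 M * fs ^+ e' * bar M =
  x ^+ (d * N) * phi (cls k (f ^+ e * G - f ^+ e' * M)).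
Proof.
move=> eq_e eq_e'; rewrite (twisted_monomial _ eq_e) (twisted_monomial _ eq_e').
by rewrite -mulrBr -!rmorphB.
Qed.

Lemma defect_p2_0 a mu e : (mu + e = q1)%N ->
  cls k (gamma *: (f ^+ a * 0 - g)) = ggen mu * cls k (- (f ^+ e * M)).
Proof.
move=> eq_q1; rewrite mulr0 gM -eq_q1 exprD -mulrA sub0r -mulrN scalerAl.
exact: rmorphM.
Qed.

Lemma twistedN_monomial e N a b P : (a + e = b + N)%N ->
  - (xz a b P * fs ^+ e * bar P) = x ^+ (d * N) * phi (cls k (- (f ^+ e * P))).
Proof. by move=> eq_e; rewrite (twisted_monomial _ eq_e) -mulrN -!rmorphN. Qed.

Lemma orth_typeIII_p2_0 omega t : (omega <= q)%N ->
  ((omega <= q1)%N ->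
     orth (idl1 (gen omega t 0)) =
     idl1 (fs ^+ (q - omega) + gm * xz q q1 M * fs ^+ (q1 - omega) * bar M)) /\
  ((q1 < omega)%N ->
     orth (idl1 (gen omega t 0)) =
     idl2 (fs ^+ (q - q1) + gm * xz q q1 M * bar M) (gm * fs ^+ (q - omega))).
Proof.
move=> omega_q; split=> le_omega.
  have eN : (omega + (q1 - omega) = q1)%N by nat_lia.
  have eX : (q + (q1 - omega) = q1 + (q - omega))%N by nat_lia.
  rewrite (orth_gen omega_q (defect_p2_0 _ eN) (twistedN_monomial _ eX)).
  by congr (idl1 _); ring.
have eX : (q + 0 = q1 + (q - q1))%N by nat_lia.
rewrite (orth_gen_unit omega_q (ltnW le_omega) (defect_p2_0 _ (addn0 q1)) _
  (twistedN_monomial _ eX)).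
  by congr (idl2 _ _); rewrite expr0; ring.
by rewrite mul1r rmorphN unitrN.
Qed.

(** Exactly one of the exponents is [0], so the sum is a unit plus a nilpotent. *)
Lemma cls_unit_subM e e' G : cls k G \is a GRing.unit -> (e == 0)%N != (e' == 0)%N ->
  cls k (f ^+ e * G - f ^+ e' * M) \is a GRing.unit.
Proof.
move=> G_unit; case: e e' => [|e] [|e'] // _; rewrite expr0 mul1r -?mulrN.
  by apply: cls_unitD_f.
by rewrite addrC; apply: cls_unitD_f; rewrite // rmorphN unitrN.
Qed.

Lemma orth_typeIII_p2 omega t G : (omega <= q)%N ->
    cls k G \is a GRing.unit ->
  ((omega < q - q1 + t)%N ->
     ((q1 < omega)%N ->
        orth (idl1 (gen omega t G)) =
        idl2 (fs ^+ (q - q1) + gm * xz q q1 M * bar M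
              - gm * xz omega t G * fs ^+ (q + t - omega - q1) * bar G)
             (gm * fs ^+ (q - omega))) /\
     ((omega <= q1)%N ->
        orth (idl1 (gen omega t G)) =
        idl1 (fs ^+ (q - omega) + gm * xz q q1 M * fs ^+ (q1 - omega) * bar M
              - gm * xz omega t G * fs ^+ (q + t - 2 * omega) * bar G))) /\
  ((q - q1 + t < omega)%N ->
     ((2 * omega <= q + t)%N ->
        orth (idl1 (gen omega t G)) =
        idl1 (fs ^+ (q - omega) + gm * xz q q1 M * fs ^+ (q1 - omega) * bar M
              - gm * xz omega t G * fs ^+ (q + t - 2 * omega) * bar G)) /\
     ((q + t < 2 * omega)%N ->
        orth (idl1 (gen omega t G)) =
        idl2 (fs ^+ (omega - t)
              + gm * xz q q1 M * fs ^+ (q1 + omega - t - q) * bar M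
              - gm * xz omega t G * bar G)
             (gm * fs ^+ (q - omega)))).
Proof.
move=> omega_q G_unit.
have single : (omega <= q1)%N -> (2 * omega <= q + t)%N ->
    orth (idl1 (gen omega t G)) =
    idl1 (fs ^+ (q - omega) + gm * xz q q1 M * fs ^+ (q1 - omega) * bar M
          - gm * xz omega t G * fs ^+ (q + t - 2 * omega) * bar G).
  move=> le1 le2.
  have eG : (omega + (q + t - 2 * omega) = q - omega + t)%N by nat_lia.
  have eM : (omega + (q1 - omega) = q1)%N by nat_lia.
  have xG : (omega + (q + t - 2 * omega) = t + (q - omega))%N by nat_lia.
  have xM : (q + (q1 - omega) = q1 + (q - omega))%N by nat_lia.
  rewrite (orth_gen omega_q (defect_p2 _ eG eM) (twistedM_monomial _ xG xM)).
  by congr (idl1 _); ring.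
split=> [lt_t|lt_t]; split=> le_omega; try by apply: single; nat_lia.
  have eG : (q1 + (q + t - omega - q1) = q - omega + t)%N by nat_lia.
  have xG : (omega + (q + t - omega - q1) = t + (q - q1))%N by nat_lia.
  have xM : (q + 0 = q1 + (q - q1))%N by nat_lia.
  rewrite (orth_gen_unit omega_q (ltnW le_omega) (defect_p2 _ eG (addn0 q1)) _
    (twistedM_monomial _ xG xM)).
    by congr (idl2 _ _); rewrite expr0; ring.
  by apply: cls_unit_subM => //; nat_lia.
have le_eps : (q - omega + t <= omega)%N by nat_lia.
have eM : (q - omega + t + (q1 + omega - t - q) = q1)%N by nat_lia.
have xG : (omega + 0 = t + (q - (q - omega + t)))%N by nat_lia.
have xM : (q + (q1 + omega - t - q) = q1 + (q - (q - omega + t)))%N by nat_lia.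
rewrite (orth_gen_unit omega_q le_eps (defect_p2 _ (addn0 _) eM) _
  (twistedM_monomial _ xG xM)); last by apply: cls_unit_subM => //; nat_lia.
have -> : (q - (q - omega + t) = omega - t)%N by nat_lia.
by congr (idl2 _ _); rewrite expr0; ring.
Qed.

Lemma orth_typeIV_p2 omega t mu kappa G : (omega <= q)%N ->
    is_kappa gamma k f omega t G kappa -> (mu < kappa)%N -> (kappa <= omega)%N ->
    (G != 0 -> cls k G \is a GRing.unit) ->
  [/\ G = 0 -> (q - q1 + mu <= omega)%N ->
        orth (idl2 (gen omega t G) (ggen mu)) =
        idl2 (fs ^+ (q - mu)) (gm * fs ^+ (q - omega)),
      G = 0 ->
        orth (idl2 (gen omega t G) (ggen mu)) =
        idl2 (fs ^+ (q - mu) + gm * xz q q1 M * fs ^+ (q1 - mu) * bar M)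
             (gm * fs ^+ (q - omega))
    & G != 0 -> (q - q1 + t)%N != omega ->
        orth (idl2 (gen omega t G) (ggen mu)) =
        idl2 (fs ^+ (q - mu) + gm * xz q q1 M * fs ^+ (q1 - mu) * bar M
              - gm * xz omega t G * fs ^+ (q + t - mu - omega) * bar G)
             (gm * fs ^+ (q - omega))].
Proof.
move=> omega_q kappaP mu_kappa kappa_omega G_unit.
have mu_omega : (mu <= omega)%N by nat_lia.
have G0 : G = 0 -> orth (idl2 (gen omega t G) (ggen mu)) =
    idl2 (fs ^+ (q - mu) + gm * xz q q1 M * fs ^+ (q1 - mu) * bar M)
         (gm * fs ^+ (q - omega)).
  move=> G0; move: kappaP; rewrite {}G0 => kappaP.
  have kappa_q1 : (kappa <= q1)%N.
    apply: (kappa_le omega_q kappaP (defect_p2_0 _ (addn0 q1))).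
    by rewrite mul1r rmorphN unitrN.
  have eM : (mu + (q1 - mu) = q1)%N by nat_lia.
  have xM : (q + (q1 - mu) = q1 + (q - mu))%N by nat_lia.
  rewrite (orth_gen_ggen omega_q (defect_p2_0 _ eM) (twistedN_monomial _ xM)) //.
  by congr (idl2 _ _); ring.
split=> // [G_eq0 le_omega|Gn0 ne_t].
  rewrite G0 //.
  (* The term in [M^*] is now a multiple of [gamma f^* ^ (q - omega)]. *)
  have -> : (q1 - mu = (q1 - mu - (q - omega)) + (q - omega))%N by nat_lia.
  rewrite -[RHS](idl2_addl _ _ (xz q q1 M * fs ^+ (q1 - mu - (q - omega)) * bar M)).
  by rewrite exprD; congr (idl2 _ _); ring.
(* The smaller of the two exponents of the defect has a unit cofactor. *)
have [kappa_t kappa_q1] : (kappa <= q - omega + t)%N /\ (kappa <= q1)%N.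
  have [lt_t|lt_t|eq_t] := ltngtP (q - omega + t) q1; last by nat_lia.
    have eM : (q - omega + t + (q1 - (q - omega + t)) = q1)%N by nat_lia.
    have := kappa_le omega_q kappaP (defect_p2 _ (addn0 _) eM).
    by move/(_ (cls_unit_subM (G_unit Gn0) _)); nat_lia.
  have eG : (q1 + (q - omega + t - q1) = q - omega + t)%N by nat_lia.
  have := kappa_le omega_q kappaP (defect_p2 _ eG (addn0 _)).
  by move/(_ (cls_unit_subM (G_unit Gn0) _)); nat_lia.
have eG : (mu + (q + t - mu - omega) = q - omega + t)%N by nat_lia.
have eM : (mu + (q1 - mu) = q1)%N by nat_lia.
have xG : (omega + (q + t - mu - omega) = t + (q - mu))%N by nat_lia.
have xM : (q + (q1 - mu) = q1 + (q - mu))%N by nat_lia.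
rewrite (orth_gen_ggen omega_q (defect_p2 _ eG eM) (twistedM_monomial _ xG xM)) //.
by congr (idl2 _ _); ring.
Qed.

(** When [omega = q - q1 + t], both terms of the defect have the exponent [q1]. *)
Section Cancellation.
Variables (omega t delta : nat) (G : {poly R}) (A : polyquo k).
Hypothesis omega_q : (omega <= q)%N.
Hypothesis omega_t : omega = (q - q1 + t)%N.
Hypothesis decomp : gdecomp gamma f q M G delta A.

Let vanishing := A = 0 \/ (A != 0 /\ (q - q1 <= delta)%N).

Lemma gammaB_cancel : cls k gamma%:P * (cls k M - cls k G) =
  cls k gamma%:P * cls k f ^+ delta * A.
Proof.
have [_ eq_MG _] := decomp; rewrite -ggenE -[RHS]eq_MG -mul_polyC.
by rewrite rmorphM rmorphB.
Qed.

Lemma defect_cancel mu e : (mu + e = q1 + delta)%N ->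
  cls k (gamma *: (f ^+ (q - omega + t) * G - g)) =
  ggen mu * cls k (- (f ^+ e * rep A)).
Proof.
move=> eq_e; have -> : (q - omega + t = q1)%N by nat_lia.
have -> : gamma *: (f ^+ q1 * G - g) = - (f ^+ q1 * (gamma%:P * (M - G))).
  by rewrite gM -mul_polyC; ring.
rewrite !rmorphN !rmorphM rmorphB !rmorphXn /= gammaB_cancel ggenE repK //.
rewrite mulrN; congr (- _).
transitivity (cls k gamma%:P * cls k f ^+ (q1 + delta) * A).
  by rewrite exprD; ring.
by rewrite -eq_e exprD; ring.
Qed.

Lemma defect_cancel0 mu : vanishing ->
  cls k (gamma *: (f ^+ (q - omega + t) * G - g)) = ggen mu * cls k 0.
Proof.
rewrite (defect_cancel (addn0 _)) mul1r rmorphN /= repK // rmorph0 mulr0 ggenE.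
case=> [->|[_ le_delta]]; first by rewrite oppr0 mulr0.
rewrite addnC -(subnK (_ : q - q1 <= delta)%N) // -addnA subnK // exprD.
by rewrite mulrCA (gammaM_fq cgamma2 cfq) mulr0 mul0r.
Qed.

(** Replacing [G] by [M] adds [gamma f^(t+delta) A] to the generator. This is [0], or
    a multiple of [gamma f^mu] since [t + delta >= omega >= mu]. *)
Lemma idl2_gen_cancel mu : (mu <= omega)%N -> vanishing ->
  idl2 (gen omega t G) (ggen mu) =
  idl2 (gen omega (omega + q1 - q) M) (ggen mu).
Proof.
move=> mu_omega vanish; have -> : (omega + q1 - q = t)%N by nat_lia.
have [c def_c] : exists c, cls k f ^+ t * (cls k f ^+ delta * A) = c * cls k f ^+ mu.
  case: vanish => [->|[_ le_delta]]; first by exists 0; rewrite !mulr0 mul0r.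
  exists (cls k f ^+ (t + delta - mu) * A).
  have le_mu : (mu <= t + delta)%N by nat_lia.
  by rewrite mulrA -exprD -{1}(subnK le_mu) exprD mulrAC.
rewrite -(idl2_addl (gen omega t G) (ggen mu) c) ggenE; congr (idl2 _ _).
rewrite !genE -addrA; congr (_ + _).
have -> : c * (cls k gamma%:P * cls k f ^+ mu) =
    cls k f ^+ t * (cls k gamma%:P * (cls k M - cls k G)).
  by rewrite gammaB_cancel mulrCA -def_c; ring.
rewrite !(rmorphM (cls k)) rmorphXn /=; ring.
Qed.

Local Notation xA :=
  (x ^ ((d * q)%N%:Z - (d * q1)%N%:Z - (d * delta)%N%:Z - (deg (rep A))%:Z)).
Local Notation As := (bar (rep A)).

Lemma twistedA_monomial e N : (q + e = q1 + delta + N)%N ->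
  - (xA * fs ^+ e * As) = x ^+ (d * N) * phi (cls k (- (f ^+ e * rep A))).
Proof.
move=> /twistedN_monomial <-; congr (- (x ^ _ * _ * _)); rewrite mulnDr; nat_lia.
Qed.

Lemma orth_typeIII_cancel :
  [/\ vanishing -> idl1 (gen omega t G) = idl1 (gen omega (omega + q1 - q) M),
      vanishing -> orth (idl1 (gen omega t G)) = idl1 (fs ^+ (q - omega)),
      A != 0 -> (omega <= q1 + delta)%N ->
        orth (idl1 (gen omega t G)) =
        idl1 (fs ^+ (q - omega) + gm * xA * fs ^+ (q1 + delta - omega) * As)
    & A != 0 -> (q1 + delta < omega)%N ->
        orth (idl1 (gen omega t G)) =
        idl2 (fs ^+ (q - q1 - delta) + gm * xA * As) (gm * fs ^+ (q - omega))].
Proof.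
split=> [vanish|vanish|An0 le_omega|An0 lt_omega].
- by rewrite !idl1_gen idl2_gen_cancel.
- rewrite (orth_gen omega_q (defect_cancel0 _ vanish) (Es := 0)) ?rmorph0 ?mulr0 //.
  by rewrite subr0.
- have eA : (omega + (q1 + delta - omega) = q1 + delta)%N by nat_lia.
  have xA : (q + (q1 + delta - omega) = q1 + delta + (q - omega))%N by nat_lia.
  rewrite (orth_gen omega_q (defect_cancel eA) (twistedA_monomial xA)).
  by congr (idl1 _); ring.
have A_unit : A \is a GRing.unit.
  by have [_ _ [A0|//]] := decomp; case/eqP: An0.
have xA : (q + 0 = q1 + delta + (q - (q1 + delta)))%N by nat_lia.
rewrite (orth_gen_unit omega_q (ltnW lt_omega) (defect_cancel (addn0 _)) _
  (twistedA_monomial xA)).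
  by rewrite subnDA; congr (idl2 _ _); rewrite expr0; ring.
by rewrite mul1r rmorphN unitrN /= repK.
Qed.

Lemma orth_typeIV_cancel mu kappa :
    is_kappa gamma k f omega t G kappa -> (mu < kappa)%N -> (kappa <= omega)%N ->
  [/\ vanishing -> idl2 (gen omega t G) (ggen mu) =
                   idl2 (gen omega (omega + q1 - q) M) (ggen mu),
      vanishing -> orth (idl2 (gen omega t G) (ggen mu)) =
                   idl2 (fs ^+ (q - mu)) (gm * fs ^+ (q - omega))
    & A != 0 -> orth (idl2 (gen omega t G) (ggen mu)) =
                idl2 (fs ^+ (q - mu)
                      + gm * xA * fs ^+ (q1 + delta - mu) * As)
                     (gm * fs ^+ (q - omega))].
Proof.
move=> kappaP mu_kappa kappa_omega; have mu_omega : (mu <= omega)%N by nat_lia.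
split=> [|vanish|An0]; first exact: idl2_gen_cancel.
  rewrite (orth_gen_ggen omega_q (defect_cancel0 _ vanish) (Es := 0))
    ?rmorph0 ?mulr0 //.
  by rewrite subr0.
have A_unit : A \is a GRing.unit.
  by have [_ _ [A0|//]] := decomp; case/eqP: An0.
have kappa_delta : (kappa <= q1 + delta)%N.
  apply: (kappa_le omega_q kappaP (defect_cancel (addn0 _))).
  by rewrite mul1r rmorphN unitrN /= repK.
have eA : (mu + (q1 + delta - mu) = q1 + delta)%N by nat_lia.
have xA : (q + (q1 + delta - mu) = q1 + delta + (q - mu))%N by nat_lia.
rewrite (orth_gen_ggen omega_q (defect_cancel eA) (twistedA_monomial xA)) //.
by congr (idl2 _ _); ring.
Qed.

End Cancellation.

End CharacteristicPSquared.

End Duality.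

(** * The orthogonal of an ideal *)

Theorem theorem3p7
  (R : finComUnitRingType) (gamma : R)
  (hchain : chain_ring R)
  (hmax : maximal_ideal (idl1 gamma))
  (hgamma0 : gamma != 0) (hgamma2 : gamma ^+ 2 = 0)
  (p m : nat) (hp : prime p)
  (F : finFieldType) (pi : {rmorphism R -> F})
  (hpi_surj : forall y : F, exists x : R, pi x = y)
  (hpi_ker : forall x : R, (pi x == 0) = (x \in idl1 gamma))
  (hF : #|F| = (p ^ m)%N)
  (hchar : has_char R p \/ has_char R (p ^ 2))
  (zeta : R) (hzeta : (p ^ m - 1).-primitive_root zeta)
  (n s : nat) (hn : (0 < n)%N) (hs : (0 < s)%N) (hnp : coprime n p)
  (alpha beta alpha0 : R)
  (halphaT : alpha \in teichmuller zeta (p ^ m - 1)) (halpha : alpha != 0)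
  (hbetaT : beta \in teichmuller zeta (p ^ m - 1))
  (halpha0T : alpha0 \in teichmuller zeta (p ^ m - 1))
  (halpha0 : alpha0 ^+ (p ^ s) = alpha)
  (r : nat) (f : 'I_r -> {poly R})
  (hf_prod : 'X^n - alpha0%:P = \prod_(i < r) f i)
  (hf_monic : forall i : 'I_r, f i \is monic)
  (hf_coprime : forall i i' : 'I_r, i != i' -> coprime_poly (f i) (f i'))
  (hf_irr : forall i, basic_irreducible pi (f i))
  (k g : 'I_r -> {poly R})
  (hk_prod : 'X^(n * p ^ s) - (alpha + gamma * beta)%:P = \prod_(i < r) k i)
  (hk : forall i, k i = f i ^+ (p ^ s) + gamma *: g i)
  (hk_monic : forall i, k i \is monic)
  (hk_coprime : forall i i' : 'I_r, i != i' -> coprime_poly (k i) (k i'))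
  (hk_deg : forall i, deg (k i) = (deg (f i) * p ^ s)%N)
  (hbeta : beta = 0)
  (M : 'I_r -> {poly R})
  (hM : has_char R (p ^ 2) -> forall i,
     k i = f i ^+ (p ^ s) + gamma *: (f i ^+ (p ^ s.-1) * M i) /\
     coprime_poly (M i) (f i))
  (j : 'I_r) (I : {set polyquo (k j)}) (hI : ideal I) :
  let T := teichmuller zeta (p ^ m - 1) in
  let q := (p ^ s)%N in
  let q1 := (p ^ s.-1)%N in
  let d := deg (f j) in
  let bar := fun c : {poly R} => cls (recip (k j)) (recip c) in
  let x : polyquo (recip (k j)) := cls (recip (k j)) 'X in
  let fs : polyquo (recip (k j)) := bar (f j) in
  let gm : polyquo (recip (k j)) := cls (recip (k j)) gamma%:P in
  let Ms : polyquo (recip (k j)) := bar (M j) in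
  let xM := x ^ ((d * q)%N%:Z - (d * q1)%N%:Z - (deg (M j))%:Z) in
  let genj := gen gamma (k j) (f j) in
  let ggenj := ggen gamma (k j) (f j) in
  [/\ (* (a) *)
      I = [set 0] -> orth I = setT,
      (* (b) *)
      I = setT -> orth I = [set 0],
      (* (c) *)
      forall tau : nat, (tau < q)%N -> I = idl1 (ggenj tau) ->
        orth I = idl2 (fs ^+ (q - tau)) gm,
      (* (d) *)
      forall (omega t : nat) (G : {poly R}),
        typeIII T gamma (k j) (f j) q omega t G ->
        I = idl1 (genj omega t G) ->
        let Gs := bar G in
        let xG := x ^ ((d * omega)%N%:Z - (d * t)%N%:Z - (deg G)%:Z) in
        (* (d)(i) *)
        (has_char R p ->
          [/\ G = 0 ->
                orth I = idl1 (fs ^+ (q - omega)),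
              G != 0 -> (2 * omega <= q + t)%N ->
                orth I = idl1 (fs ^+ (q - omega)
                               - gm * xG * fs ^+ (q + t - 2 * omega) * Gs)
            & G != 0 -> (q + t < 2 * omega)%N ->
                orth I = idl2 (fs ^+ (omega - t) - gm * xG * Gs)
                              (gm * fs ^+ (q - omega))]) /\
        (* (d)(ii) *)
        (has_char R (p ^ 2) ->
          [/\ exists (delta : nat) (A : polyquo (k j)),
                gdecomp gamma (f j) q (M j) G delta A,
              G = 0 -> (omega <= q1)%N ->
                orth I = idl1 (fs ^+ (q - omega)
                               + gm * xM * fs ^+ (q1 - omega) * Ms),
              G = 0 -> (q1 < omega)%N ->
                orth I = idl2 (fs ^+ (q - q1) + gm * xM * Ms)
                              (gm * fs ^+ (q - omega)),
              G != 0 -> (omega < q - q1 + t)%N ->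
                ((q1 < omega)%N ->
                  orth I = idl2 (fs ^+ (q - q1) + gm * xM * Ms
                                 - gm * xG * fs ^+ (q + t - omega - q1) * Gs)
                                (gm * fs ^+ (q - omega))) /\
                ((omega <= q1)%N ->
                  orth I = idl1 (fs ^+ (q - omega)
                                 + gm * xM * fs ^+ (q1 - omega) * Ms
                                 - gm * xG * fs ^+ (q + t - 2 * omega) * Gs))
            & G != 0 -> (q - q1 + t < omega)%N ->
                ((2 * omega <= q + t)%N ->
                  orth I = idl1 (fs ^+ (q - omega)
                                 + gm * xM * fs ^+ (q1 - omega) * Ms
                                 - gm * xG * fs ^+ (q + t - 2 * omega) * Gs)) /\
                ((q + t < 2 * omega)%N ->
                  orth I = idl2 (fs ^+ (omega - t)
                                 + gm * xM * fs ^+ (q1 + omega - t - q) * Ms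
                                 - gm * xG * Gs)
                                (gm * fs ^+ (q - omega)))] /\
          forall (delta : nat) (A : polyquo (k j)),
            gdecomp gamma (f j) q (M j) G delta A ->
            let As := bar (rep A) in
            let xA := x ^ ((d * q)%N%:Z - (d * q1)%N%:Z - (d * delta)%N%:Z
                           - (deg (rep A))%:Z) in
            G != 0 -> omega = (q - q1 + t)%N ->
            [/\ A = 0 \/ (A != 0 /\ (q - q1 <= delta)%N) ->
                  I = idl1 (genj omega (omega + q1 - q)%N (M j)),
                A = 0 \/ (A != 0 /\ (q - q1 <= delta)%N) ->
                  orth I = idl1 (fs ^+ (q - omega)),
                A != 0 -> (omega <= q1 + delta)%N -> (delta < q - q1)%N ->
                  orth I = idl1 (fs ^+ (q - omega)
                                 + gm * xA * fs ^+ (q1 + delta - omega) * As)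
              & A != 0 -> (q1 + delta < omega)%N ->
                  orth I = idl2 (fs ^+ (q - q1 - delta) + gm * xA * As)
                                (gm * fs ^+ (q - omega))])
    & (* (e) *)
      forall (omega t mu : nat) (G : {poly R}),
        typeIV T gamma (k j) (f j) q omega t mu G ->
        I = idl2 (genj omega t G) (ggenj mu) ->
        let Gs := bar G in
        let xG := x ^ ((d * omega)%N%:Z - (d * t)%N%:Z - (deg G)%:Z) in
        (* (e)(i) *)
        (has_char R p ->
          (G = 0 ->
            orth I = idl2 (fs ^+ (q - mu)) (gm * fs ^+ (q - omega))) /\
          (G != 0 ->
            orth I = idl2 (fs ^+ (q - mu)
                           - gm * xG * fs ^+ (q + t - mu - omega) * Gs)
                          (gm * fs ^+ (q - omega)))) /\
        (* (e)(ii) *)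
        (has_char R (p ^ 2) ->
          [/\ exists (delta : nat) (A : polyquo (k j)),
                gdecomp gamma (f j) q (M j) G delta A,
              G = 0 -> (q - q1 + mu <= omega)%N ->
                orth I = idl2 (fs ^+ (q - mu)) (gm * fs ^+ (q - omega)),
              G = 0 -> (omega < q - q1 + mu)%N ->
                orth I = idl2 (fs ^+ (q - mu)
                               + gm * xM * fs ^+ (q1 - mu) * Ms)
                              (gm * fs ^+ (q - omega))
            & G != 0 -> (q - q1 + t)%N != omega ->
                orth I = idl2 (fs ^+ (q - mu)
                               + gm * xM * fs ^+ (q1 - mu) * Ms
                               - gm * xG * fs ^+ (q + t - mu - omega) * Gs)
                              (gm * fs ^+ (q - omega))] /\
          forall (delta : nat) (A : polyquo (k j)),
            gdecomp gamma (f j) q (M j) G delta A ->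
            let As := bar (rep A) in
            let xA := x ^ ((d * q)%N%:Z - (d * q1)%N%:Z - (d * delta)%N%:Z
                           - (deg (rep A))%:Z) in
            G != 0 -> omega = (q - q1 + t)%N ->
            [/\ A = 0 \/ (A != 0 /\ (q - q1 <= delta)%N) ->
                  I = idl2 (genj omega (omega + q1 - q)%N (M j)) (ggenj mu),
                A = 0 \/ (A != 0 /\ (q - q1 <= delta)%N) ->
                  orth I = idl2 (fs ^+ (q - mu)) (gm * fs ^+ (q - omega))
              & A != 0 -> (delta < q - q1)%N ->
                  orth I = idl2 (fs ^+ (q - mu)
                                 + gm * xA * fs ^+ (q1 + delta - mu) * As)
                                (gm * fs ^+ (q - omega))])].
Proof.
pose q := (p ^ s)%N; pose q1 := (p ^ s.-1)%N.
have p_gt0 := prime_gt0 hp.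
have q_gt0 : (0 < q)%N by rewrite expn_gt0 p_gt0.
have q1_q : (q1 <= q)%N by rewrite leq_pexp2l // leq_pred.
have k_defn := hk j.
have f_irr := hf_irr j.
have k_monic := hk_monic j.
have size_k := size_k_gt1 hpi_ker k_defn q_gt0 k_monic f_irr.
have lead_k := lead_k_unit k_monic.
have alpha_unit : alpha \is a GRing.unit.
  move: halphaT; rewrite inE inE (negPf halpha) /= => /imsetP[i _ ->].
  apply: unitrX; have N_gt0 := prim_order_gt0 hzeta.
  apply/unitrPr; exists (zeta ^+ (p ^ m - 1).-1).
  by rewrite -exprS prednK // prim_expr_order.
rewrite hbeta mulr0 addr0 in hk_prod.
have k0 : (k j)`_0 \is a GRing.unit.
  have : (\prod_i k i)`_0 = - alpha.
    rewrite -hk_prod coefB coefXn coefC /= eq_sym -leqn0 leqNgt muln_gt0 hn /=.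
    by rewrite q_gt0 sub0r.
  rewrite (bigD1 j) //= coef0M => /(congr1 (fun c => c \is a GRing.unit)).
  by rewrite unitrN alpha_unit unitrM => /andP[].
have [phi [phi_bij phiE]] := reciprocal_isomorphism size_k lead_k k0.
have k_charp : has_char R p -> k j = f j ^+ q + gamma *: 0.
  move=> charp; rewrite scaler0 addr0.
  apply: (monic_factor_unique hpi_ker hgamma0 hgamma2 hf_monic hf_coprime hk).
    exact: hk_monic.
  rewrite prodrXl -hf_prod -hk_prod -halpha0.
  have p_char : p \in [pchar {poly R}].
    by rewrite inE hp /= -polyC_natr polyC_eq0 charp dvdnn.
  have q_nat : [pchar {poly R}].-nat q.
    by rewrite (eq_pnat _ (pcharf_eq p_char)) pnatX pnat_id.
  (* Additivity of the Frobenius map is applied to [x^n = (x^n - alpha0) + alpha0],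
     which avoids the sign of [(- alpha0)^q]. *)
  rewrite polyC_exp exprM -{1}(subrK (alpha0%:P) 'X^n) exprDn_pchar //.
  by rewrite addrK.
have unit_G G N T : zero_or_unit_expansion T (k j) (f j) N G ->
  G != 0 -> cls (k j) G \is a GRing.unit by case=> [->|[]//]; rewrite eqxx.
have decomp_ex :=
  gdecomp_exists hpi_surj hpi_ker hgamma2 k_defn q_gt0 k_monic f_irr (M j).
move=> T q' q1' d bar x fs gm Ms xM genj ggenj; split.
- by move=> ->; apply: orth_set0 phiE.
- by move=> ->; apply: orth_setT phiE.
- move=> tau /ltnW tau_q ->.
  exact: (orth_ggen hpi_surj hpi_ker hgamma0 hgamma2 q_gt0 k_monic f_irr k0
    phi_bij phiE k_defn tau_q).
- move=> omega t G [/andP[_ /ltnW omega_q] [kappa [_ _ expG]]] -> Gs xG.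
  split=> [charp|charp2].
    exact: (orth_typeIII_p hpi_surj hpi_ker hgamma0 hgamma2 q_gt0 k_monic f_irr k0
      phi_bij phiE (k_charp charp) erefl t omega_q (unit_G _ _ _ expG)).
  have [k_charp2 cop_M] := hM charp2 j.
  have M_unit := coprime_cls_unit hpi_ker hgamma2 k_defn q_gt0 k_monic f_irr cop_M.
  split.
    split.
    + exact: decomp_ex.
    + move=> ->; exact: (orth_typeIII_p2_0 hpi_surj hpi_ker hgamma0 hgamma2 q_gt0
        k_monic f_irr k0 phi_bij phiE k_charp2 q1_q erefl M_unit t omega_q).1.
    + move=> ->; exact: (orth_typeIII_p2_0 hpi_surj hpi_ker hgamma0 hgamma2 q_gt0
        k_monic f_irr k0 phi_bij phiE k_charp2 q1_q erefl M_unit t omega_q).2.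
    + move=> /(unit_G _ _ _ expG) G_unit; exact: (orth_typeIII_p2 hpi_surj hpi_ker
        hgamma0 hgamma2 q_gt0 k_monic f_irr k0 phi_bij phiE k_charp2 q1_q erefl
        M_unit t omega_q G_unit).1.
    move=> /(unit_G _ _ _ expG) G_unit; exact: (orth_typeIII_p2 hpi_surj hpi_ker
      hgamma0 hgamma2 q_gt0 k_monic f_irr k0 phi_bij phiE k_charp2 q1_q erefl
      M_unit t omega_q G_unit).2.
  move=> delta A decomp As xA Gn0 omega_t.
  have [eq_I orth0 orth1 orth2] := orth_typeIII_cancel hpi_surj hpi_ker hgamma0 hgamma2
    q_gt0 k_monic f_irr k0 phi_bij phiE k_charp2 q1_q erefl omega_q omega_t decomp.
  by split=> // An0 le_omega _; apply: orth1.
move=> omega t mu G [kappa [kappaP [mu_kappa kappa_omega /ltnW omega_q] _ expG]].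
move=> -> Gs xG; have G_unit := unit_G _ _ _ expG.
split=> [charp|charp2].
  exact: (orth_typeIV_p hpi_surj hpi_ker hgamma0 hgamma2 q_gt0 k_monic f_irr k0
    phi_bij phiE (k_charp charp) erefl omega_q kappaP mu_kappa kappa_omega G_unit).
have [k_charp2 cop_M] := hM charp2 j.
have M_unit := coprime_cls_unit hpi_ker hgamma2 k_defn q_gt0 k_monic f_irr cop_M.
split.
  have [orth0 orth1 orth2] := orth_typeIV_p2 hpi_surj hpi_ker hgamma0 hgamma2 q_gt0
    k_monic f_irr k0 phi_bij phiE k_charp2 q1_q erefl M_unit omega_q kappaP mu_kappa
    kappa_omega G_unit.
  by split=> // G0 _; apply: orth1.
move=> delta A decomp As xA Gn0 omega_t.
have [eq_I orth0 orth1] := orth_typeIV_cancel hpi_surj hpi_ker hgamma0 hgamma2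
  q_gt0 k_monic f_irr k0 phi_bij phiE k_charp2 q1_q erefl omega_q omega_t decomp
  kappaP mu_kappa kappa_omega.
by split=> // An0 _; apply: orth1.
Qed.
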